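(* Let $T$ be a complete $\mathrm{NSOP}_1$ theory with monster model $\mathbb{M}$. Then Kim-independence satisfies algebraically reasonable extension: for every $M\prec\mathbb{M}$ and all tuples $a,b$ with $a\perp^K_M b$, and for any tuple $c$, there exists $a'$ such that $a'\equiv_{Mb}a$, $a'\perp^K_M bc$, and further $a'\perp^a_{Mb}c$.
   Context: $\mathrm{NSOP}_1$: a formula $\varphi(x;y)$ has $\mathrm{SOP}_1$ modulo a complete theory $T$ with monster model $\mathbb{M}$ if there is a tree of tuples $(a_\eta)_{\eta\in 2^{<\omega}}$ in $\mathbb{M}$ such that (i) for all $\eta\in 2^\omega$, $\{\varphi(x;a_{\eta|\alpha}) : \alpha<\omega\}$ is consistent, and (ii) for all $\nu,\eta\in 2^{<\omega}$, if $\nu^\frown\langle 0\rangle\trianglelefteq\eta$ then $\{\varphi(x;a_\eta),\varphi(x;a_{\nu^\frown\langle1\rangle})\}$ is inconsistent. $T$ is $\mathrm{NSOP}_1$ if no formula has $\mathrm{SOP}_1$ modulo $T$. Kim-independence (over $M\prec\mathbb{M}$): a global type $q\in S(\mathbb{M})$ is $M$-invariant if it is fixed by $\mathrm{Aut}(\mathbb{M}/M)$; a Morley sequence over $M$ in $q$ is a sequence $(b_i)_{i\in I}$ with $b_i\models q|_{M(b_j)_{j<i}}$. A formula $\varphi(x;b)$ Kim-divides over $M$ if there is a global $M$-invariant type $q\supseteq\mathrm{tp}(b/M)$ such that, for $(b_i)_{i<\omega}$ a Morley sequence over $M$ in $q$, $\{\varphi(x;b_i): i<\omega\}$ is inconsistent.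 A partial type Kim-divides over $M$ if it implies a formula which Kim-divides over $M$. Write $a\perp^K_M b$ if $\mathrm{tp}(a/Mb)$ does not Kim-divide over $M$. Algebraic independence: $a\perp^a_C b$ iff $\mathrm{acl}(Ca)\cap\mathrm{acl}(Cb)=\mathrm{acl}(C)$. $a\equiv_C a'$ means $\mathrm{tp}(a/C)=\mathrm{tp}(a'/C)$. Models, sets and tuples are small; tuples may be infinite. *)

(* Defs.v *)
From HB Require Import structures.
From mathcomp Require Import all_boot all_order.
From mathcomp Require Import boolp classical_sets functions cardinality.

Set Implicit Arguments.
Unset Strict Implicit.
Unset Printing Implicit Defensive.

Local Open Scope classical_set_scope.
Local Open Scope card_scope.

(** * First-order logic *)

Record language := Language {
  fsym : Type;
  rsym : Type;
  farity : fsym -> nat;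
  rarity : rsym -> nat }.

Inductive term (L : language) (V : Type) : Type :=
| tVar of V
| tFun (f : fsym L) of ('I_(farity f) -> term L V).

(* [form L V]: first-order formulas with equality whose free variables are
   indexed by [V]. In [fAll], [None] is the newly bound variable and [Some v]
   is the old variable [v]. *)
Inductive form (L : language) (V : Type) : Type :=
| fFalse
| fEq of term L V & term L V
| fRel (r : rsym L) of ('I_(rarity r) -> term L V)
| fImp of form L V & form L V
| fAll of form L (option V).

Arguments fFalse {L V}.

Definition fNot (L : language) (V : Type) (p : form L V) : form L V :=
  fImp p fFalse.

Fixpoint tmap (L : language) (V W : Type) (g : V -> W) (t : term L V) :
    term L W :=
  match t with
  | tVar v => tVar L (g v)
  | tFun f ts => tFun (fun i => tmap g (ts i))
  end.

Fixpoint fmap (L : language) (V W : Type) (g : V -> W) (p : form L V) :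
    form L W :=
  match p with
  | fFalse => fFalse
  | fEq s t => fEq (tmap g s) (tmap g t)
  | fRel r ts => fRel (fun i => tmap g (ts i))
  | fImp p1 p2 => fImp (fmap g p1) (fmap g p2)
  | fAll p1 => fAll (fmap (omap g) p1)
  end.

(* [structure L D] is an [L]-structure with universe [D]. *)
Record structure (L : language) (D : Type) := Structure {
  s_inh : inhabited D;
  s_fun : forall f : fsym L, ('I_(farity f) -> D) -> D;
  s_rel : forall r : rsym L, ('I_(rarity r) -> D) -> Prop }.

Fixpoint teval (L : language) (D : Type) (S : structure L D) (V : Type)
    (v : V -> D) (t : term L V) : D :=
  match t with
  | tVar x => v x
  | tFun f ts => s_fun S (fun i => teval S v (ts i))
  end.

Fixpoint holds (L : language) (D : Type) (S : structure L D) (V : Type)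
    (v : V -> D) (p : form L V) : Prop :=
  match p with
  | fFalse => False
  | fEq s t => teval S v s = teval S v t
  | fRel r ts => s_rel S (fun i => teval S v (ts i))
  | fImp p1 p2 => holds S v p1 -> holds S v p2
  | fAll p1 => forall x : D, holds S (oapp v x) p1
  end.

Definition sentence (L : language) := form L void.

Definition models (L : language) (D : Type) (S : structure L D)
    (T : set (sentence L)) : Prop :=
  forall p, T p -> holds S (of_void D) p.

Definition entails (L : language) (T : set (sentence L)) (p : sentence L) :
    Prop :=
  forall (D : Type) (S : structure L D), models S T -> holds S (of_void D) p.

Definition complete_theory (L : language) (T : set (sentence L)) : Prop :=
  (exists (D : Type) (S : structure L D), models S T) /\
  (forall p : sentence L, entails T p \/ entails T (fNot p)).

(* [elementary S M]: the subset [M] is the universe of an elementary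
   substructure of [S]. *)
Definition elementary (L : language) (D : Type) (S : structure L D)
    (M : set D) : Prop :=
  exists N : structure L M, forall (n : nat) (p : form L 'I_n) (v : 'I_n -> M),
    holds N v p <-> holds S (fun i => val (v i)) p.

Definition automorphism (L : language) (D : Type) (S : structure L D)
    (s : D -> D) : Prop :=
  [/\ bijective s,
      forall (f : fsym L) (d : 'I_(farity f) -> D),
        s (s_fun S d) = s_fun S (s \o d) &
      forall (r : rsym L) (d : 'I_(rarity r) -> D),
        s_rel S d <-> s_rel S (s \o d)].

(** * Types over a fixed structure *)

(* A formula in the variables [X] with parameters in [D] is an element of
   [form L (X + D)]: [inl x] is the variable [x], [inr d] the parameter [d].
   [inst b phi] is phi(x; b), for phi(x; y) with [y] indexed by [Y]. *)
Definition inst (L : language) (X Y D : Type) (b : Y -> D)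
    (phi : form L (X + Y)) : form L (X + D) :=
  fmap (fun w => match w with inl x => inl x | inr y => inr (b y) end) phi.

Definition sat (L : language) (D : Type) (S : structure L D) (X : Type)
    (a : X -> D) (phi : form L (X + D)) : Prop :=
  holds S (fun w => match w with inl x => a x | inr d => d end) phi.

Definition over (L : language) (X D : Type) (C : set D) :
    set (form L (X + D)) :=
  range (@inst L X C D (fun c => val c)).

Definition tp (L : language) (D : Type) (S : structure L D) (X : Type)
    (a : X -> D) (C : set D) : set (form L (X + D)) :=
  [set phi | over C phi /\ sat S a phi].

Definition realizes (L : language) (D : Type) (S : structure L D) (X : Type)
    (a : X -> D) (pi : set (form L (X + D))) : Prop :=
  forall phi, pi phi -> sat S a phi.

(* Consistency is with respect to the elementary diagram of [S], that is,
   finite satisfiability in [S]. *)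
Definition consistent (L : language) (D : Type) (S : structure L D) (X : Type)
    (pi : set (form L (X + D))) : Prop :=
  forall F, finite_set F -> F `<=` pi -> exists a : X -> D, realizes S a F.

Definition complete_type (L : language) (D : Type) (S : structure L D)
    (X : Type) (C : set D) (p : set (form L (X + D))) : Prop :=
  [/\ p `<=` over C,
      consistent S p &
      forall phi, over C phi -> p phi \/ p (fNot phi)].

Definition global_type (L : language) (D : Type) (S : structure L D)
    (X : Type) (q : set (form L (X + D))) : Prop :=
  complete_type S [set: D] q.

(** * Monster models *)

(* The cardinal kappa is that of the type [K]; small means of cardinality
   < kappa. *)
Definition small (K A : Type) (B : set A) : Prop :=
  (B #<= [set: K]) /\ ~ ([set: K] #<= B).

Definition strong_limit (K : Type) : Prop :=
  small K [set: nat] /\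
  (forall A : Type, small K [set: A] -> small K [set: set A]).

Definition saturated (L : language) (K D : Type) (S : structure L D) : Prop :=
  forall (C : set D) (p : set (form L (unit + D))),
    small K C -> complete_type S C p -> exists a : unit -> D, realizes S a p.

Definition strongly_homogeneous (L : language) (K D : Type)
    (S : structure L D) : Prop :=
  forall (I : Type) (a a' : I -> D), small K [set: I] ->
    tp S a set0 = tp S a' set0 ->
    exists s : D -> D, automorphism S s /\ (forall i, s (a i) = a' i).

(* A monster model of [T]: kappa-saturated and strongly kappa-homogeneous, for
   a strong limit cardinal kappa > |T|. *)
Definition monster (L : language) (K D : Type) (T : set (sentence L))
    (S : structure L D) : Prop :=
  [/\ strong_limit K, small K [set: fsym L] /\ small K [set: rsym L],
      models S T, saturated K S & strongly_homogeneous K S].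

(** * NSOP1 *)

(* 2^{<omega} is [seq bool], with [false] for 0 and [true] for 1. *)
Definition has_SOP1 (L : language) (D : Type) (S : structure L D) (n m : nat)
    (phi : form L ('I_n + 'I_m)) : Prop :=
  exists a : seq bool -> 'I_m -> D,
    (forall eta : nat -> bool,
       consistent S [set inst (a (mkseq eta k)) phi | k in [set: nat]]) /\
    (forall nu eta : seq bool, prefix (rcons nu false) eta ->
       ~ consistent S [set inst (a eta) phi; inst (a (rcons nu true)) phi]).

Definition NSOP1 (L : language) (D : Type) (S : structure L D) : Prop :=
  forall (n m : nat) (phi : form L ('I_n + 'I_m)), ~ has_SOP1 S phi.

(** * Kim-independence and algebraic independence *)

Definition invariant (L : language) (D : Type) (S : structure L D) (X : Type)
    (M : set D) (q : set (form L (X + D))) : Prop :=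
  forall s : D -> D, automorphism S s -> (forall m, M m -> s m = m) ->
    inst s @` q = q.

Definition morley_seq (L : language) (D : Type) (S : structure L D) (X : Type)
    (M : set D) (q : set (form L (X + D))) (d : Order.disp_t)
    (I : orderType d) (b : I -> X -> D) : Prop :=
  forall i : I,
    realizes S (b i)
      (q `&` over (M `|` \bigcup_(j in [set j | (j < i)%O]) range (b j))).

(* All Morley sequences over [M] in [q] indexed by omega have the same type
   over [M], hence the universal quantifier over them. *)
Definition kim_divides (L : language) (D : Type) (S : structure L D)
    (M : set D) (X : Type) (n : nat) (phi : form L (X + 'I_n))
    (b : 'I_n -> D) : Prop :=
  exists q : set (form L ('I_n + D)),
    [/\ global_type S q, invariant S M q, tp S b M `<=` q &
        forall b_ : nat -> 'I_n -> D, morley_seq S M q b_ ->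
          ~ consistent S [set inst (b_ i) phi | i in [set: nat]]].

Definition implies (L : language) (D : Type) (S : structure L D) (X : Type)
    (pi : set (form L (X + D))) (psi : form L (X + D)) : Prop :=
  forall a : X -> D, realizes S a pi -> sat S a psi.

Definition type_kim_divides (L : language) (D : Type) (S : structure L D)
    (M : set D) (X : Type) (pi : set (form L (X + D))) : Prop :=
  exists (n : nat) (phi : form L (X + 'I_n)) (b : 'I_n -> D),
    implies S pi (inst b phi) /\ kim_divides S M phi b.

Definition kim_indep (L : language) (D : Type) (S : structure L D)
    (M : set D) (I J : Type) (a : I -> D) (b : J -> D) : Prop :=
  ~ type_kim_divides S M (tp S a (M `|` range b)).

Definition acl (L : language) (D : Type) (S : structure L D) (C : set D) :
    set D :=
  [set e | exists phi : form L (unit + D),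
    [/\ over C phi, sat S (fun=> e) phi &
        finite_set [set x | sat S (fun=> x) phi]]].

Definition alg_indep (L : language) (D : Type) (S : structure L D)
    (C : set D) (I J : Type) (a : I -> D) (b : J -> D) : Prop :=
  acl S (C `|` range a) `&` acl S (C `|` range b) = acl S C.

Definition tuple_cat (D I J : Type) (a : I -> D) (b : J -> D) : I + J -> D :=
  fun k => match k with inl i => a i | inr j => b j end.

(* Main.v *)
From Stdlib Require List.
From mathcomp Require Import all_boot all_order.
From mathcomp Require Import boolp classical_sets functions cardinality filter.
Require Import Defs.

(** Algebraically reasonable extension is a refinement of extension for
    Kim-independence, and the refinement is a matter of taking many copies.

    Write [B] for [Mb]. Suppose [psi] is a formula of [tp(a/B)], and that
    finitely many formulas over [Bc], each implying one that Kim-divides over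
    [M], have to be avoided. Suppose also that finitely many elements [e] of
    [acl(Bc)] outside [acl(B)] have to be kept out of certain [a']-definable
    sets of size at most [k]. By Neumann's lemma ([neumann],
    [disjoint_copies_ex]) there are as many automorphisms [t] over [B] as one
    likes that send these [e] to pairwise disjoint sets. Extension, in its
    finitary form [kim_extension_fin], gives an [a'] realizing [psi] that avoids
    the Kim-dividing formulas for all the copies of [c] at the same time. The
    sets of size [k] attached to [a'] meet only boundedly many of the disjoint
    copies of the [e], so some [t] is good, and its inverse moves [a'] to a
    solution ([reasonable_extension_fin]). Compactness does the rest.

    Extension itself says that a formula [psi] of [tp(a/B)] implies no
    disjunction of Kim-dividing formulas. Take a Morley sequence in a coheir of
    the type over [M] of all the parameters. As [psi] does not Kim-divide, its
    instances along the sequence have a common realization; by the pigeonhole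
    principle this realization satisfies the instances of one disjunct along a
    long subsequence, which is again a Morley sequence in an invariant type.
    The disjunct divides along Morley sequences in some invariant type, perhaps
    another one, so Kim's lemma ([kim_lemma]) is needed: whether a formula
    divides does not depend on the invariant type.

    This is where NSOP1 enters. If [phi(x;b)] divides along [q] but not along
    [r], both invariant and extending [tp(b/M)], then a tree witnessing SOP1 is
    built from the leaves to the root ([tree_ex], [SOP1_of_invariant_types]).
    A left node continues a Morley sequence in [r], so that branches are
    consistent; a right node is the image of its left sibling under an
    automorphism over [M] which makes it start with a realization of [q] over
    the whole left subtree. *)

Set Implicit Arguments.
Unset Strict Implicit.
Unset Printing Implicit Defensive.

Local Open Scope classical_set_scope.
Local Open Scope card_scope.

(** * Lists *)

Lemma In_cat (A : Type) (x : A) (s t : seq A) :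
  List.In x (s ++ t) <-> List.In x s \/ List.In x t.
Proof.
elim: s => [|y s IH] /=; first by split; [right|case].
by rewrite IH or_assoc.
Qed.

Lemma In_map (A B : Type) (f : A -> B) (y : B) (s : seq A) :
  List.In y (map f s) <-> exists2 x, List.In x s & f x = y.
Proof.
elim: s => [|z s IH] /=; first by split=> // -[].
rewrite IH; split.
  by case=> [e|[x xs e]]; [exists z => //; left | exists x => //; right].
by case=> x [->|xs] e; [left | right; exists x].
Qed.

Lemma In_mem (A : eqType) (x : A) (s : seq A) : List.In x s <-> x \in s.
Proof.
elim: s => [|y s IH] //=; rewrite inE IH; split.
  by case=> [->|->]; rewrite ?eqxx ?orbT.
by case/orP=> [/eqP->|]; [left | right].
Qed.

Lemma In_nth (A : Type) (x0 : A) (s : seq A) i :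
  i < size s -> List.In (nth x0 s i) s.
Proof.
by elim: s i => [|x s IH] [|i] //= h; [left | right; apply: IH].
Qed.

Lemma In_nthP (A : Type) (x0 x : A) (s : seq A) :
  List.In x s -> exists2 i, i < size s & nth x0 s i = x.
Proof.
elim: s => [|y s IH] //= [->|/IH[i ? ?]]; first by exists 0.
by exists i.+1.
Qed.

Lemma finite_set_In (A : Type) (F : set A) :
  finite_set F <-> exists s : seq A, forall x, F x <-> List.In x s.
Proof.
split.
  have := @finite_seqP {classic A} F => -[+ _] fF => /(_ fF)[s es].
  by exists s => x; rewrite (In_mem (x : {classic A}) s) es.
case=> s es; apply/(@finite_seqP {classic A}); exists s.
by apply/seteqP; split=> x; rewrite /= -(In_mem (x : {classic A}) s) es.
Qed.

Lemma finite_listP (A : Type) (F : set A) : finite_set F ->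
  exists s : seq A, forall x, F x <-> List.In x s.
Proof. by move/finite_set_In. Qed.

(** * Syntax: substitution, finite support, quantification over tuples *)

Definition sum_map (X Y X' Y' : Type) (f : X -> X') (g : Y -> Y') (w : X + Y) :
    X' + Y' :=
  match w with inl x => inl (f x) | inr y => inr (g y) end.

Lemma tuple_cat_map (D X Y X' Y' : Type) (f : X -> X') (g : Y -> Y')
    (a : X' -> D) (b : Y' -> D) :
  tuple_cat a b \o sum_map f g = tuple_cat (a \o f) (b \o g).
Proof. by apply/funext=> -[]. Qed.

Section Syntax.
Context (L : language).

Lemma tmap_comp (V W Z : Type) (g : V -> W) (h : W -> Z) (t : term L V) :
  tmap h (tmap g t) = tmap (h \o g) t.
Proof. by elim: t => //= f ts IH; congr tFun; apply/funext. Qed.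

Lemma omap_comp (V W Z : Type) (g : V -> W) (h : W -> Z) :
  omap h \o omap g = omap (h \o g).
Proof. by apply/funext => -[]. Qed.

Lemma fmap_comp (V W Z : Type) (g : V -> W) (h : W -> Z) (p : form L V) :
  fmap h (fmap g p) = fmap (h \o g) p.
Proof.
elim: p W Z g h => //= [{}V s t|{}V r ts|{}V p1 IH1 p2 IH2|{}V p1 IH1] W Z g h.
- by rewrite !tmap_comp.
- by congr fRel; apply/funext => i; rewrite tmap_comp.
- by rewrite IH1 IH2.
- by rewrite IH1 omap_comp.
Qed.

Lemma tmap_id (V : Type) (t : term L V) : tmap id t = t.
Proof. by elim: t => //= f ts IH; congr tFun; apply/funext. Qed.

Lemma fmap_id (V : Type) (p : form L V) : fmap id p = p.
Proof.
elim: p => //= [{}V s t|{}V r ts|{}V p1 IH1 p2 IH2|{}V p1 IH1].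
- by rewrite !tmap_id.
- by congr fRel; apply/funext => i; rewrite tmap_id.
- by rewrite IH1 IH2.
- by rewrite (_ : omap id = id) ?IH1 //; apply/funext => -[].
Qed.

Lemma teval_tmap (D : Type) (S : structure L D) (V W : Type) (g : V -> W)
    (v : W -> D) (t : term L V) : teval S v (tmap g t) = teval S (v \o g) t.
Proof. by elim: t => //= f ts IH; congr s_fun; apply/funext. Qed.

Lemma holds_fmap (D : Type) (S : structure L D) (V W : Type) (g : V -> W)
    (v : W -> D) (p : form L V) : holds S v (fmap g p) = holds S (v \o g) p.
Proof.
elim: p W g v => //= [{}V s t|{}V r ts|{}V p1 IH1 p2 IH2|{}V p1 IH1] W g v.
- by rewrite !teval_tmap.
- by congr s_rel; apply/funext => i; rewrite teval_tmap.
- by rewrite IH1 IH2.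
- apply/propext; split=> h x; have := h x; rewrite IH1;
    by rewrite (_ : _ \o _ = oapp (v \o g) x) //; apply/funext => -[].
Qed.

Lemma tmap_support (V : Type) (t : term L V) : exists2 l : set V, finite_set l &
  forall (W : Type) (g h : V -> W),
    (forall v, l v -> g v = h v) -> tmap g t = tmap h t.
Proof.
elim: t => [v|f ts IH].
  by exists [set v] => [|W g h e /=]; [exact: finite_set1 | rewrite e].
have /choice[l hl] : forall i, exists l : set V, finite_set l /\
    forall (W : Type) (g h : V -> W),
    (forall v, l v -> g v = h v) -> tmap g (ts i) = tmap h (ts i).
  by move=> i; have [l ? ?] := IH i; exists l.
exists (\bigcup_i l i) => [|W g h e /=].
  by apply: bigcup_finite => [|i _]; [exact: finite_finset | case: (hl i)].
congr tFun; apply/funext => i; apply: (hl i).2 => v lv.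
by apply: e; exists i.
Qed.

Lemma form_support (V : Type) (p : form L V) : exists2 l : set V, finite_set l &
  forall (W : Type) (g h : V -> W),
    (forall v, l v -> g v = h v) -> fmap g p = fmap h p.
Proof.
elim: p => [{}V|{}V s t|{}V r ts|{}V p1 [l1 f1 h1] p2 [l2 f2 h2]|{}V p1 [l fl hl]].
- by exists set0.
- have [l1 f1 h1] := tmap_support s; have [l2 f2 h2] := tmap_support t.
  exists (l1 `|` l2) => [|W g h e /=]; first by rewrite finite_setU.
  by congr fEq; [apply: h1 | apply: h2] => v lv; apply: e; [left|right].
- have /choice[l hl] : forall i, exists l : set V, finite_set l /\
      forall (W : Type) (g h : V -> W),
      (forall v, l v -> g v = h v) -> tmap g (ts i) = tmap h (ts i).
    by move=> i; have [l ? ?] := tmap_support (ts i); exists l.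
  exists (\bigcup_i l i) => [|W g h e /=].
    by apply: bigcup_finite => [|i _]; [exact: finite_finset | case: (hl i)].
  congr fRel; apply/funext => i; apply: (hl i).2 => v lv.
  by apply: e; exists i.
- exists (l1 `|` l2) => [|W g h e /=]; first by rewrite finite_setU.
  by congr fImp; [apply: h1 | apply: h2] => v lv; apply: e; [left|right].
- exists (Some @^-1` l) => [|W g h e /=].
    by apply: finite_preimage => // x y _ _ [].
  by congr fAll; apply: hl => -[v|] //= lv; rewrite e.
Qed.

(** Evaluation in a structure on [D] commutes with the substitution of elements
    of [D] for variables, so a support for substitution is one for truth. *)
Lemma holds_support (D : Type) (S : structure L D) (V : Type) (p : form L V) :
  exists2 l : set V, finite_set l & forall v w : V -> D,
    (forall x, l x -> v x = w x) -> holds S v p = holds S w p.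
Proof.
have [l fl hl] := form_support p; exists l => // v w e.
by have := holds_fmap S v id p; rewrite (hl _ _ _ e) holds_fmap /= => <-.
Qed.

(** Only finitely many variables occur, so ['I_n] suffices. Having [f] besides
    [g] lets tuples indexed by [X] and by ['I_n] be turned into one another, so
    that quantifying over either kind gives the same truth value. *)
Lemma fin_left (X Y : Type) (p : form L (X + Y)) :
  exists (n : nat) (f : X -> 'I_n) (g : 'I_n -> X),
    fmap (sum_map g id) (fmap (sum_map f id) p) = p.
Proof.
have [[x0]|nX] := pselect (inhabited X); last first.
  have f0 (x : X) : 'I_0 by case: nX.
  exists 0, f0, (fun i : 'I_0 => match notF (valP i) with end).
  rewrite fmap_comp (_ : _ \o _ = id) ?fmap_id //.
  by apply/funext => -[x|] //; case: nX.
have [l fl hl] := form_support p.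
have [s es] := @finite_listP X (inl @^-1` l)
   (finite_preimage (fun x y _ _ (e : inl x = inl y) =>
      let: erefl := e in erefl) fl).
exists (size s).+1, (fun x => inord (index (x : {classic X}) s)),
  (fun i => nth x0 s i).
rewrite fmap_comp -[RHS]fmap_id; apply: hl => -[x|y] //= lx.
have /es/(In_mem (x : {classic X})) xs : (inl @^-1` l) x by [].
by rewrite inordK ?(nth_index (x0 : {classic X}) xs) // ltnS index_size.
Qed.

Definition sum_swap (X Y : Type) (w : X + Y) : Y + X :=
  match w with inl x => inr x | inr y => inl y end.

Lemma fin_right (X Y : Type) (p : form L (X + Y)) :
  exists (n : nat) (g : 'I_n -> Y) (p' : form L (X + 'I_n)),
    fmap (sum_map id g) p' = p.
Proof.
have [n [f [g e]]] := fin_left (fmap (@sum_swap X Y) p).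
exists n, g, (fmap (@sum_swap _ _) (fmap (sum_map f id) (fmap (@sum_swap X Y) p))).
have := congr1 (fmap (@sum_swap _ _)) e; rewrite !fmap_comp.
rewrite (_ : @sum_swap Y X \o @sum_swap X Y = id); last by apply/funext => -[].
rewrite fmap_id => e'; rewrite -[RHS]e'; congr fmap.
by apply/funext => -[].
Qed.

Lemma holds_fNot (D : Type) (S : structure L D) (V : Type) (v : V -> D)
  (p : form L V) : holds S v (fNot p) = (~ holds S v p).
Proof. by []. Qed.

Definition fEx (V : Type) (p : form L (option V)) : form L V :=
  fNot (fAll (fNot p)).

Lemma holds_fEx (D : Type) (S : structure L D) (V : Type) (v : V -> D)
    (p : form L (option V)) :
  holds S v (fEx p) <-> exists d, holds S (oapp v d) p.
Proof.
rewrite /fEx /= -/(~ _) -existsNE; split=> [[d /contrapT h]|[d h]]; exists d => //.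
Qed.

(** Existential quantification over a tuple of any length, even infinite: only
    the variables in the support of [p] matter. *)
Lemma ex_tuple (X Z : Type) (p : form L (X + Z)) :
  exists psi : form L Z, forall (D : Type) (S : structure L D) (v : Z -> D),
    holds S v psi <-> exists x : X -> D, holds S (tuple_cat x v) p.
Proof.
suff main n Z' (q : form L ('I_n + Z')) : exists psi : form L Z',
    forall (D : Type) (S : structure L D) (v : Z' -> D),
    holds S v psi <-> exists x : 'I_n -> D, holds S (tuple_cat x v) q.
  have [n [f [g e]]] := fin_left p.
  have [psi hpsi] := main _ _ (fmap (sum_map f id) p).
  exists psi => D S v; rewrite hpsi; split=> -[x].
    by rewrite holds_fmap tuple_cat_map => h; exists (x \o f).
  by rewrite -{1}e holds_fmap tuple_cat_map => h; exists (x \o g).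
elim: n Z' q => [|n IH] Z' q.
  pose f (w : 'I_0 + Z') := match w with
    | inl i => match notF (valP i) with end | inr z => z end.
  exists (fmap f q) => D S v; rewrite holds_fmap.
  have e x : v \o f = tuple_cat x v by apply/funext => -[[]|].
  split=> [h|[x]]; last by rewrite -(e x).
  by exists (v \o f \o inl); rewrite -e.
pose f (w : 'I_n.+1 + Z') : 'I_n + option Z' := match w with
  | inl i => if unlift ord0 i is Some j then inl j else inr None
  | inr z => inr (Some z) end.
have [psi hpsi] := IH _ (fmap f q).
exists (fEx psi) => D S v; rewrite holds_fEx; split.
  case=> d /hpsi[x]; rewrite holds_fmap => h.
  exists (fun i => if unlift ord0 i is Some j then x j else d).
  rewrite (_ : tuple_cat _ _ = tuple_cat x (oapp v d) \o f) //.
  by apply/funext => -[i|z] //=; case: unlift.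
case=> x h; exists (x ord0); apply/hpsi; exists (x \o lift ord0).
rewrite holds_fmap (_ : _ \o _ = tuple_cat x v) //.
by apply/funext => -[i|z] //=; case: unliftP => [j|] ->.
Qed.

End Syntax.

(** * Small sets *)

Lemma card_leTP (A B : Type) :
  ([set: A] #<= [set: B])%card <-> exists f : A -> B, injective f.
Proof.
split.
  move/card_leP=> [f].
  exists (fun x => val (f (exist _ x (mem_set I)))) => x y /val_inj.
  by move=> e; have [] := @inj _ _ _ f _ _ (mem_set I) (mem_set I) e.
case=> f fI; have e : f @` setT #= [set: A] by apply: inj_card_eq => x y _ _ /fI.
by rewrite -(card_le_eql e) card_leT.
Qed.

Section Comparability.
Context (A B : Type).

Let pinj (G : set (A * B)) := forall p p', G p -> G p' -> (p.1 = p'.1 <-> p.2 = p'.2).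

(** A maximal partial injection exhausts one of the two types. *)
Lemma injection_total :
  (exists f : A -> B, injective f) \/ (exists f : B -> A, injective f).
Proof.
have [] := @Zorn_bigcup _ pinj.
  move=> F FP totF p p' [G FG Gp] [G' FG' Gp'].
  by case: (totF _ _ FG FG') => /(_ _ _)s; [apply: (FP _ FG') | apply: (FP _ FG)] => //;
    apply: s.
move=> G [Gp maxG].
have [h|/existsNP[x hx]] := pselect (forall x, exists y, G (x, y)).
  left; have [f hf] := choice h; exists f => x y e.
  exact: ((Gp _ _ (hf x) (hf y)).2 e).
have [h|/existsNP[y hy]] := pselect (forall y, exists x, G (x, y)).
  right; have [f hf] := choice h; exists f => x' y e.
  exact: ((Gp _ _ (hf x') (hf y)).1 e).
exfalso; apply: (maxG (G `|` [set (x, y)])).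
  split; first by move=> p; left.
  by move=> /(_ (x, y) (or_intror erefl)) h; apply: hx; exists y.
move=> p p' [Gp1|->] [Gp2|->] //=; first exact: Gp.
  split=> e; exfalso; [apply: hx; exists p.2|apply: hy; exists p.1];
    by rewrite -e -surjective_pairing.
split=> e; exfalso; [apply: hx; exists p'.2|apply: hy; exists p'.1];
    by rewrite e -surjective_pairing.
Qed.

End Comparability.

Section Small.
Context (K : Type).

Lemma small_inj (A B : Type) (f : A -> B) :
  injective f -> small K [set: B] -> small K [set: A].
Proof.
move=> fI [sB nB]; have le : ([set: A] #<= [set: B])%card.
  by apply/card_leTP; exists f.
by split=> [|/card_le_trans/(_ le)//]; exact: card_le_trans sB.
Qed.

Lemma small_setT (A : Type) (B : set A) : small K B <-> small K [set: B].
Proof.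
by rewrite /small (card_le_eql (card_setT B)) (card_le_eqr (card_setT B)).
Qed.

Lemma small_subset (A : Type) (B C : set A) : B `<=` C -> small K C -> small K B.
Proof.
move=> /subset_card_le le [sC nC].
by split=> [|/card_le_trans/(_ le)//]; exact: card_le_trans sC.
Qed.

Lemma small_image (A B : Type) (f : A -> B) (C : set A) :
  small K C -> small K (f @` C).
Proof.
have le := card_image_le f C; move=> [sC nC].
by split=> [|/card_le_trans/(_ le)//]; exact: card_le_trans sC.
Qed.

Hypothesis slK : strong_limit K.

Lemma small_countType (A : countType) : small K [set: A].
Proof. exact: small_inj (pcan_inj (@choice.pickleK A)) slK.1. Qed.

Lemma small_set0 (A : Type) : small K (@set0 A).
Proof.
apply/small_setT; apply: (@small_inj _ nat (fun=> 0)) slK.1.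
by case=> x hx; case: (set_mem hx).
Qed.

(** With [A], [B] and [nat] embedded in one small type [Z], the sum [A + B]
    embeds in the power set of [Z]: elements of [A] become singletons, elements
    of [B] complements of singletons. *)
Lemma small_sum (A B : Type) :
  small K [set: A] -> small K [set: B] -> small K [set: (A + B)%type].
Proof.
move=> sA sB.
have ub (X Y : Type) : small K [set: X] -> small K [set: Y] ->
    exists Z : Type, [/\ small K [set: Z], exists f : X -> Z, injective f
      & exists f : Y -> Z, injective f].
  move=> sX sY; have [[f fI]|[f fI]] := injection_total X Y.
    by exists Y; split=> //; [exists f | exists id].
  by exists X; split=> //; [exists id | exists f].
have [Y [sY [f fI] [g gI]]] := ub _ _ sA sB.
have [Z [sZ [h hI] [e eI]]] := ub _ _ sY slK.1.
pose c (w : A + B) : set Z := match w with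
  | inl x => [set h (f x)] | inr y => ~` [set h (g y)] end.
have other (u v : Z) : exists w, w <> u /\ w <> v.
  apply: contrapT => no.
  have no' n : e n = u \/ e n = v.
    have [->|nu] := pselect (e n = u); first by left.
    by have [->|nv] := pselect (e n = v); [right | case: no; exists (e n)].
  by case: (no' 0) => e0; case: (no' 1) => e1; case: (no' 2) => e2;
    have := eI 0 1; have := eI 0 2; have := eI 1 2;
    rewrite e0 e1 e2 => a1 a2 a3;
    first [have := a1 erefl | have := a2 erefl | have := a3 erefl].
have neq x y : [set h (f x)] <> ~` [set h (g y)].
  move=> E; have [w [wx wy]] := other (h (f x)) (h (g y)).
  by have : (~` [set h (g y)]) w by []; rewrite -E.
apply: (@small_inj _ _ c); last exact: slK.2.
move=> [x|y] [x'|y'] /= E.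
- have : [set h (f x')] (h (f x)) by rewrite -E.
  by move=> /hI/fI->.
- by case: (neq _ _ E).
- by case: (neq _ _ (esym E)).
- have : [set h (g y')] (h (g y)) by rewrite -[X in X _]setCK -E setCK.
  by move=> /hI/gI->.
Qed.

Lemma small_setU (A : Type) (B C : set A) :
  small K B -> small K C -> small K (B `|` C).
Proof.
move=> /small_setT sB /small_setT sC.
have := small_image (fun w : B + C => match w with inl x => val x | inr x => val x end)
  (small_sum sB sC).
apply: small_subset => x [Bx|Cx].
  by exists (inl (exist _ x (mem_set Bx))).
by exists (inr (exist _ x (mem_set Cx))).
Qed.

Lemma small_setU_range (A Y : Type) (B : set A) (b : Y -> A) :
  small K B -> small K [set: Y] -> small K (B `|` range b).
Proof. by move=> sB sY; apply: small_setU => //; exact: small_image. Qed.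

End Small.

(** * Definable predicates and saturation *)

(** Complete types are obtained below from ultrafilters on sets of tuples:
    completeness and finite satisfiability are then immediate. *)
Lemma ultrafilter_fip (T : Type) (Q : set (set T)) :
  (forall s : seq (set T), (forall A, List.In A s -> Q A) ->
     exists x, forall A, List.In A s -> A x) ->
  exists G : set_system T, UltraFilter G /\ Q `<=` G.
Proof.
move=> fip.
pose B (s : seq (set T)) := [set x | forall A, List.In A s -> A x].
pose F := filter_from [set s | forall A, List.In A s -> Q A] B.
have FF : ProperFilter F.
  apply: filter_from_proper => [|s /fip//].
  apply: filter_from_filter => [|s t hs ht]; first by exists [::].
  exists (s ++ t) => [A /In_cat[/hs|/ht]//|x h].
  by split=> A hA; apply: h; apply/In_cat; [left|right].
have [G [UG FG]] := ultraFilterLemma FF; exists G; split=> // A QA.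
apply: FG; exists [:: A] => [_ [<-|[]]|x] //; apply; by left.
Qed.

Section Definable.
Context (L : language) (D : Type) (U : structure L D).

(** Definability over [C] of a set of tuples, given as a predicate: most formulas
    below are only needed up to equivalence, and are never written out. *)
Definition dfn (X : Type) (C : set D) (P : (X -> D) -> Prop) : Prop :=
  exists theta : form L (X + C),
    forall a, holds U (tuple_cat a (fun c : C => val c)) theta <-> P a.

Lemma satE (X : Type) (a : X -> D) (phi : form L (X + D)) :
  sat U a phi = holds U (tuple_cat a id) phi.
Proof. by []. Qed.

Lemma sat_inst (X Y : Type) (a : X -> D) (b : Y -> D) (phi : form L (X + Y)) :
  sat U a (inst b phi) = holds U (tuple_cat a b) phi.
Proof.
have -> : inst b phi = fmap (sum_map id b) phi by [].
by rewrite satE holds_fmap tuple_cat_map.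
Qed.

Lemma dfn_iff (X : Type) (C : set D) (P Q : (X -> D) -> Prop) :
  (forall a, P a <-> Q a) -> dfn C P -> dfn C Q.
Proof. by move=> PQ [th h]; exists th => a; rewrite h. Qed.

Lemma dfn_sat (X : Type) (C : set D) (phi : form L (X + D)) :
  over C phi -> dfn C (fun a => sat U a phi).
Proof. by case=> th _ <-; exists th => a; rewrite sat_inst. Qed.

Lemma dfn_over (X : Type) (C : set D) (P : (X -> D) -> Prop) : dfn C P ->
  exists2 phi, over C phi & forall a, sat U a phi <-> P a.
Proof.
case=> th h; exists (inst (fun c : C => val c) th); first by exists th.
by move=> a; rewrite sat_inst.
Qed.

Lemma over_subset (X : Type) (C C' : set D) : C `<=` C' ->
  @over L X D C `<=` over C'.
Proof.
move=> CC' _ [th _ <-].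
exists (inst (fun c : C => exist _ (val c) (mem_set (CC' _ (set_mem (valP c)))) : C') th) => //.
by rewrite /inst fmap_comp; congr fmap; apply/funext => -[].
Qed.

Lemma dfn_subset (X : Type) (C C' : set D) (P : (X -> D) -> Prop) :
  C `<=` C' -> dfn C P -> dfn C' P.
Proof.
move=> CC' /dfn_over[phi /(over_subset CC')/dfn_sat d h].
exact: dfn_iff d.
Qed.

Lemma dfn_not (X : Type) (C : set D) (P : (X -> D) -> Prop) :
  dfn C P -> dfn C (fun a => ~ P a).
Proof. by move=> [th h]; exists (fNot th) => a; rewrite holds_fNot h. Qed.

Lemma dfn_imp (X : Type) (C : set D) (P Q : (X -> D) -> Prop) :
  dfn C P -> dfn C Q -> dfn C (fun a => P a -> Q a).
Proof. by move=> [th h] [ph k]; exists (fImp th ph) => a /=; rewrite h k. Qed.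

Lemma dfn_and (X : Type) (C : set D) (P Q : (X -> D) -> Prop) :
  dfn C P -> dfn C Q -> dfn C (fun a => P a /\ Q a).
Proof.
move=> dP dQ; apply: dfn_iff (dfn_not (dfn_imp dP (dfn_not dQ))) => a.
by split=> [/not_implyP[? /contrapT]|[p q] /(_ p)].
Qed.

Lemma dfn_true (X : Type) (C : set D) : dfn C (fun _ : X -> D => True).
Proof. by exists (fNot fFalse) => a; rewrite holds_fNot; split=> // _ []. Qed.

Lemma dfn_forall_In (X I : Type) (C : set D) (P : I -> (X -> D) -> Prop)
    (s : seq I) : (forall i, List.In i s -> dfn C (P i)) ->
  dfn C (fun a => forall i, List.In i s -> P i a).
Proof.
elim: s => [|i s IH] h; first by apply: dfn_iff (dfn_true _ _).
apply: dfn_iff (dfn_and (h i (or_introl erefl)) (IH (fun j js => h j (or_intror js)))).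
by move=> a; split=> [[hi hs] j [<-|/hs]//|hs]; split=> [|j js]; apply: hs; [left|right].
Qed.

Lemma dfn_forall_fin (X : Type) (I : finType) (C : set D)
    (P : I -> (X -> D) -> Prop) : (forall i, dfn C (P i)) ->
  dfn C (fun a => forall i, P i a).
Proof.
move=> h; apply: dfn_iff (dfn_forall_In (s := enum I) (fun i _ => h i)) => a.
by split=> hP i => [|_]; apply: hP; apply/In_mem; rewrite mem_enum.
Qed.

Lemma dfn_comp (X Y : Type) (f : X -> Y) (C : set D) (P : (X -> D) -> Prop) :
  dfn C P -> dfn C (fun a : Y -> D => P (a \o f)).
Proof.
move=> [th h]; exists (fmap (sum_map f id) th) => a.
by rewrite holds_fmap tuple_cat_map h.
Qed.

Lemma dfn_ex (W X : Type) (C : set D) (P : (W + X -> D) -> Prop) :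
  dfn C P -> dfn C (fun a => exists w : W -> D, P (tuple_cat w a)).
Proof.
move=> [th h].
pose f (w : (W + X) + C) : W + (X + C) := match w with
  | inl (inl w) => inl w | inl (inr x) => inr (inl x) | inr c => inr (inr c) end.
have [psi hpsi] := ex_tuple (fmap f th); exists psi => a; rewrite hpsi.
have e w : tuple_cat w (tuple_cat a (fun c : C => val c)) \o f =
    tuple_cat (tuple_cat w a) (fun c : C => val c).
  by apply/funext => -[[]|].
by split=> -[w hw]; exists w; [apply/h; rewrite -e -holds_fmap |
  rewrite holds_fmap e; apply/h].
Qed.

Lemma dfn_param (X Y : Type) (C : set D) (c : Y -> D) (psi : form L (X + Y)) :
  range c `<=` C -> dfn C (fun a => holds U (tuple_cat a c) psi).
Proof.
move=> cC; pose c' y : C := exist _ (c y) (mem_set (cC _ (imageT c y))).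
exists (fmap (sum_map id c') psi) => a.
by rewrite holds_fmap tuple_cat_map.
Qed.

Lemma dfn_holds (X : Type) (C : set D) (psi : form L X) :
  dfn C (fun a => holds U a psi).
Proof. by exists (fmap inl psi) => a; rewrite holds_fmap. Qed.

Lemma dfn_eq (X : Type) (C : set D) (x y : X) : dfn C (fun a => a x = a y).
Proof. by exists (fEq (tVar L (inl x)) (tVar L (inl y))). Qed.

Lemma dfn_eq_param (X : Type) (C : set D) (x : X) (d : D) : C d ->
  dfn C (fun a => a x = d).
Proof.
move=> Cd.
by exists (fEq (tVar L (inl x)) (tVar L (inr (exist _ d (mem_set Cd))))).
Qed.

Lemma dfn_support (X : Type) (C : set D) (P : (X -> D) -> Prop) : dfn C P ->
  exists s : seq X, forall a a',
    (forall x, List.In x s -> a x = a' x) -> P a -> P a'.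
Proof.
move=> [th h]; have [l fl hl] := holds_support U th.
have [s es] := @finite_listP X (inl @^-1` l) (finite_preimage (in2W (@inl_inj X C)) fl).
exists s => a a' e /h; rewrite (hl _ (tuple_cat a' (fun c : C => val c))) => [/h//|].
by move=> [x|c] //= lx; apply/e/es.
Qed.

(** An ultrafilter containing [Q] decides every formula over [C], and so yields a
    complete type to which saturation applies. *)
Lemma compactness_unary (K : Type) (C : set D) (Q : set ((unit -> D) -> Prop)) :
  saturated K U -> small K C -> (forall P, Q P -> dfn C P) ->
  (forall s, (forall P, List.In P s -> Q P) -> exists a, forall P, List.In P s -> P a) ->
  exists a, forall P, Q P -> P a.
Proof.
move=> sat_U sC dQ fip; have [G [UG QG]] := ultrafilter_fip fip.
have GP : ProperFilter G by exact: ultra_proper.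
pose p := [set th | over C th /\ G (fun a => sat U a th)].
have [|a ha] := sat_U C p sC.
  split=> [th []//|F fF Fp|th oth].
  - have [s es] := finite_listP fF.
    suff: G (fun a => forall th, List.In th s -> sat U a th).
      by move/filter_ex => [a ha]; exists a => th /es/ha.
    have {fF Fp es} : forall th, List.In th s -> p th by move=> th /es/Fp.
    elim: s => [|th s IH] h; first by apply: filterS filterT.
    have Gth := (h th (or_introl erefl)).2.
    have Gs := IH (fun x xs => h x (or_intror xs)).
    by apply: filterS (filterI Gth Gs) => a [ath as_] x [<-|/as_].
  - have [Gth|Gth] := in_ultra_setVsetC (fun a => sat U a th) UG; [by left|right].
    split=> //; case: oth => th' _ <-.
    by exists (fNot th').
exists a => P QP; have [th oth hth] := dfn_over (dQ _ QP).
by apply/hth/ha; split=> //; apply: filterS (QG _ QP) => b /hth.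
Qed.

(** Saturation for small tuples. A maximal set [E] of assignments [x = d]
    finitely compatible with [Q] assigns a value to every variable [x0]: the
    conditions that [Q] and [E] impose on [x0] form a type over a small set. *)
Theorem compactness (K X : Type) (C : set D) (Q : set ((X -> D) -> Prop)) :
  strong_limit K -> saturated K U -> small K [set: X] -> small K C ->
  (forall P, Q P -> dfn C P) ->
  (forall s, (forall P, List.In P s -> Q P) -> exists a, forall P, List.In P s -> P a) ->
  exists a, forall P, Q P -> P a.
Proof.
move=> slK sat_U sX sC dQ fip.
pose comp (E : set (X * D)) := forall s l,
  (forall P, List.In P s -> Q P) -> (forall e, List.In e l -> E e) ->
  exists a, (forall P, List.In P s -> P a) /\
            (forall e, List.In e l -> a e.1 = e.2).
have [|E [cE maxE]] := @Zorn_bigcup _ comp.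
  move=> F FC totF s l hs hl.
  have [->|[A FA lA]] : l = [::] \/ exists2 A, F A & forall e, List.In e l -> A e.
    elim: l hl => [|e l IH] hl; first by left.
    right; have [A FA Ae] := hl e (or_introl erefl).
    have [l0|[B FB lB]] := IH (fun e el => hl e (or_intror el)).
      by exists A => // e' [<-//|]; rewrite l0.
    have [AB|BA] := totF _ _ FA FB.
      by exists B => // e' [<-|/lB//]; apply: AB.
    by exists A => // e' [<-//|/lB/BA].
  - by have [a ha] := fip s hs; exists a.
  - exact: FC FA s l hs lA.
have total x0 : exists d, E (x0, d).
  (* [C'] is small because [E] is the graph of a partial function on [X]. *)
  pose C' := C `|` [set d | exists x, E (x, d)].
  have Efun x d d' : E (x, d) -> E (x, d') -> d = d'.
    move=> e e'; have [//||a [_ ha]] := cE [::] [:: (x, d); (x, d')].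
      by move=> _ [<-|[<-|[]]].
    by have := ha (x, d) (or_introl erefl); have /= := ha (x, d') (or_intror (or_introl erefl)) => -> ->.
  have sC' : small K C'.
    apply: small_setU => //.
    have [[d0]|nD] := pselect (inhabited D); last first.
      by apply: (@small_subset _ _ _ (@set0 D)) => [d|]; [case: nD |
        apply: small_subset sC].
    have /choice[g hg] : forall x, exists y, forall d, E (x, d) -> y = d.
      move=> x.
      have [[d Ed]|nE] := pselect (exists d, E (x, d)).
        by exists d => d'; apply: Efun.
      by exists d0 => d Ed; case: nE; exists d.
    by apply: small_subset (small_image g sX) => d [x /hg<-]; exists x.
  pose cond s l (y : unit -> D) := exists a : X -> D,
    [/\ forall P, List.In P s -> P a, forall e, List.In e l -> a e.1 = e.2
      & a x0 = y tt].
  pose S := [set R | exists s l, [/\ forall P, List.In P s -> Q P,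
    forall e, List.In e l -> E e & R = cond s l]].
  have [R [s [l [hs hl ->]]]|Rs hRs|y hy] := compactness_unary sat_U sC' (Q := S).
  - pose B (a : X + unit -> D) :=
      (forall P, List.In P s -> P (a \o inl)) /\
      ((forall e, List.In e l -> a (inl e.1) = e.2) /\ a (inl x0) = a (inr tt)).
    have dB : dfn C' B.
      apply: dfn_and.
        apply: (dfn_forall_In (P := fun P a => P (a \o inl))) => P /hs QP.
        apply: (@dfn_comp _ _ inl _ P); apply: dfn_subset (dQ _ QP) => d.
        by left.
      apply: dfn_and; last exact: dfn_eq.
      apply: (dfn_forall_In (P := fun e a => a (inl e.1) = e.2)) => -[x d] /hl Ee.
      by apply: dfn_eq_param; right; exists x.
    apply: dfn_iff (dfn_ex dB) => y; split=> [[a [h1 [h2 h3]]]|[a [h1 h2 h3]]].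
      by exists a.
    by exists a.
  - suff [s [l [hs hl hR]]] : exists s l, [/\ forall P, List.In P s -> Q P,
        forall e, List.In e l -> E e &
        forall R, List.In R Rs -> forall y, cond s l y -> R y].
      have [a [ha1 ha2]] := cE s l hs hl.
      exists (fun=> a x0) => R /hR; apply; by exists a.
    elim: Rs hRs => [|R Rs IH] hRs; first by exists [::], [::].
    have [s [l [hs hl hR]]] := IH (fun R RI => hRs R (or_intror RI)).
    have [s' [l' [hs' hl' ->]]] := hRs R (or_introl erefl).
    exists (s ++ s'), (l ++ l'); split.
    + by move=> P /In_cat[/hs|/hs'].
    + by move=> P /In_cat[/hl|/hl'].
    + move=> R' R'I y [a [h1 h2 h3]]; case: R'I => [<-|R'I].
        by exists a; split=> // z hz; [apply: h1|apply: h2]; apply/In_cat; right.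
      apply: hR R'I _ _.
      by exists a; split=> // z hz; [apply: h1|apply: h2]; apply/In_cat; left.
  - exists (y tt); apply: contrapT => nE.
    apply: (maxE (E `|` [set (x0, y tt)])).
      split=> [e|]; first by left.
      by move=> /(_ (x0, y tt) (or_intror erefl)).
    move=> s l hs hl.
    have [l' hl' ll'] : exists2 l', (forall e, List.In e l' -> E e) &
        forall e, List.In e l -> List.In e l' \/ e = (x0, y tt).
      elim: l hl => [|e l IH] hl; first by exists [::].
      have [l' h1 h2] := IH (fun e el => hl e (or_intror el)).
      have [Ee|->] := hl e (or_introl erefl).
        exists (e :: l') => [e' [<-//|/h1]//|e' [<-|/h2[]]];
          by [left; left | left; right | right].
      by exists l' => // e' [<-|/h2]; [right|].
    have [|a [h1 h2 h3]] := hy (cond s l'); first by exists s, l'.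
    by exists a; split=> // e /ll'[/h2//|->].
have [a ha] := choice total; exists a => P QP.
have [s hs] := dfn_support (dQ _ QP).
have [||a' [h1 h2]] := cE [:: P] [seq (x, a x) | x <- s].
- by move=> _ [<-|[]].
- by move=> e /In_map[x _ <-].
apply: (hs a') => [x xs|]; last by apply: h1; left.
by apply: (h2 (x, a x)); apply/In_map; exists x.
Qed.

End Definable.

(** * Automorphisms *)

Section Automorphisms.
Context (L : language) (D : Type) (U : structure L D).

Lemma auto_teval (s : D -> D) (V : Type) (v : V -> D) (t : term L V) :
  automorphism U s -> teval U (s \o v) t = s (teval U v t).
Proof.
case=> _ hf _; elim: t => //= f ts IH; rewrite hf; congr s_fun.
by apply/funext => i; rewrite IH.
Qed.

Lemma auto_holds (s : D -> D) (V : Type) (v : V -> D) (p : form L V) :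
  automorphism U s -> holds U (s \o v) p = holds U v p.
Proof.
move=> sA; case: (sA) => -[s' sK s'K] _ hr.
elim: p v => //= [{}V t t'|{}V r ts|{}V p1 IH1 p2 IH2|{}V p1 IH1] v.
- by rewrite !auto_teval //; apply/propext; split=> [/(can_inj sK)|->].
- apply/propext; rewrite (hr r (fun i => teval U v (ts i))).
  by rewrite (_ : s \o _ = fun i => teval U (s \o v) (ts i)) //;
    apply/funext => i; rewrite auto_teval.
- by rewrite IH1 IH2.
- have e x : oapp (s \o v) (s x) = s \o oapp v x by apply/funext => -[].
  apply/propext; split=> h x; first by rewrite -IH1 -e.
  by rewrite -(s'K x) e IH1.
Qed.

Lemma auto_id : automorphism U id.
Proof. by split=> //; exists id. Qed.

Lemma auto_comp (s t : D -> D) :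
  automorphism U s -> automorphism U t -> automorphism U (s \o t).
Proof.
move=> [bs fs rs] [bt ft rt]; split; first exact: bij_comp.
- by move=> f d /=; rewrite ft fs.
- by move=> r d; rewrite rt rs.
Qed.

Lemma auto_inv (s : D -> D) : automorphism U s ->
  exists s', [/\ automorphism U s', cancel s s' & cancel s' s].
Proof.
move=> [[s' sK s'K] fs rs]; exists s'; split=> //; split.
- by exists s.
- move=> f d; apply: (can_inj sK); rewrite s'K fs; congr s_fun.
  by apply/funext => i /=; rewrite s'K.
- move=> r d; rewrite (rs r (s' \o d)) (_ : s \o (s' \o d) = d) //.
  by apply/funext => i /=; rewrite s'K.
Qed.

Definition fixes (B : set D) (s : D -> D) := forall m, B m -> s m = m.

Lemma fixes_comp (B : set D) (s t : D -> D) :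
  fixes B s -> fixes B t -> fixes B (s \o t).
Proof. by move=> hs ht m Bm /=; rewrite ht // hs. Qed.

Lemma fixes_inv (B : set D) (s s' : D -> D) :
  cancel s s' -> fixes B s -> fixes B s'.
Proof. by move=> sK hs m Bm; rewrite -{1}(hs m Bm) sK. Qed.

Lemma holds_fixes (X : Type) (B : set D) (s : D -> D) (a : X -> D)
    (p : form L (X + B)) : automorphism U s -> fixes B s ->
  holds U (tuple_cat (s \o a) (fun c : B => val c)) p =
  holds U (tuple_cat a (fun c : B => val c)) p.
Proof.
move=> sA sB; rewrite -(auto_holds (tuple_cat a _) p sA); congr (holds U _ p).
by apply/funext => -[x|c] //=; rewrite sB //; apply: set_mem (valP c).
Qed.

Lemma sat_inst_auto (X : Type) (s : D -> D) (a : X -> D) (phi : form L (X + D)) :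
  automorphism U s -> sat U (s \o a) (inst s phi) = sat U a phi.
Proof.
move=> sA; rewrite sat_inst satE -(auto_holds (tuple_cat a id) _ sA).
congr (holds U _ phi).
by apply/funext => -[].
Qed.

(** Strong homogeneity over [B] reduces to that over the empty set by adding an
    enumeration of [B] to both tuples. *)
Lemma homogeneous_over (K Y : Type) (B : set D) (c c' : Y -> D) :
  strong_limit K -> strongly_homogeneous K U -> small K [set: Y] -> small K B ->
  (forall th : form L (Y + B), holds U (tuple_cat c (fun b : B => val b)) th ->
     holds U (tuple_cat c' (fun b : B => val b)) th) ->
  exists s, [/\ automorphism U s, fixes B s & s \o c = c'].
Proof.
move=> slK hom sY /small_setT sB h.
have h' (th : form L (Y + B)) : holds U (tuple_cat c (fun b : B => val b)) th =
    holds U (tuple_cat c' (fun b : B => val b)) th.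
  apply/propext; split=> [/h//|h1]; apply: contrapT => h2.
  exact: (h (fNot th) h2 h1).
have [|s [sA hs]] := hom _ (tuple_cat c (fun b : B => val b))
    (tuple_cat c' (fun b : B => val b)) (small_sum slK sY sB).
  rewrite /tp; apply/seteqP; split=> [phi [[th _ <-]]|phi [[th _ <-]]];
    rewrite sat_inst => hth; split; try (by exists th); rewrite sat_inst;
    pose f (w : (Y + B) + (set0 : set D)) : Y + B := match w with
      | inl i => i | inr e => match set_mem (valP e) with end end.
    have e a : a \o f = tuple_cat a (fun b : (set0 : set D) => val b).
      by apply/funext => -[x|[x hx]] //; case: (set_mem hx).
    by rewrite -e -holds_fmap -h' holds_fmap e.
  have e a : a \o f = tuple_cat a (fun b : (set0 : set D) => val b).
    by apply/funext => -[x|[x hx]] //; case: (set_mem hx).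
  by rewrite -e -holds_fmap h' holds_fmap e.
exists s; split=> // [b Bb|]; last by apply/funext => y; apply: (hs (inl y)).
exact: (hs (inr (exist _ b (mem_set Bb)))).
Qed.

End Automorphisms.

(** * Invariant types and Morley chains *)

Section Chains.
Context (L : language) (K D : Type) (U : structure L D) (slK : strong_limit K).
Context (satU : saturated K U) (homU : strongly_homogeneous K U).
Context (Y : Type) (sY : small K [set: Y]).
Implicit Types (q : set (form L (Y + D))) (B M : set D) (cs : seq (Y -> D)).

Lemma over_setT (X : Type) (phi : form L (X + D)) : over [set: D] phi.
Proof.
exists (inst (fun d => exist _ d (mem_set I) : [set: D]) phi) => //.
rewrite /inst fmap_comp -[RHS]fmap_id; congr fmap.
by apply/funext => -[].
Qed.

Lemma global_typeP q B (c : Y -> D) phi : global_type U q ->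
  realizes U c (q `&` over B) -> over B phi -> q phi <-> sat U c phi.
Proof.
move=> [_ _ cq] hc oph; split=> [qp|sp]; first by apply: hc.
case: (cq phi) => //; first exact: over_setT.
move=> qn; have /hc : (q `&` over B) (fNot phi) by split=> //;
  case: oph => th _ <-; exists (fNot th).
by move=> /(_ sp).
Qed.

Lemma realizes_subset q B B' (c : Y -> D) : B `<=` B' ->
  realizes U c (q `&` over B') -> realizes U c (q `&` over B).
Proof. by move=> BB hc phi [qp op]; apply: hc; split=> //; apply: over_subset op. Qed.

Lemma realizes_conj q B (c c' : Y -> D) : global_type U q -> small K B ->
  realizes U c (q `&` over B) -> realizes U c' (q `&` over B) ->
  exists s, [/\ automorphism U s, fixes B s & s \o c = c'].
Proof.
move=> gq sB hc hc'; apply: homogeneous_over slK homU sY sB _ => th.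
have o : over B (inst (fun b : B => val b) th) by exists th.
rewrite -!sat_inst => h.
exact/(global_typeP gq hc' o)/(global_typeP gq hc o).
Qed.

Lemma realizes_ex q B : global_type U q -> small K B ->
  exists c, realizes U c (q `&` over B).
Proof.
move=> gq sB.
have [P [phi [_ op] <-]|s hs|c hc] := @compactness L D U K Y B
   [set (fun a => sat U a phi) | phi in q `&` over B] slK satU sY sB.
- exact: dfn_sat.
- have [F [fF Fq hF]] : exists F, [/\ finite_set F, F `<=` q &
      forall a, realizes U a F -> forall P, List.In P s -> P a].
    elim: s hs => [|P s IH] hs; first by exists set0; split=> // a _ P [].
    have [F [fF Fq hF]] := IH (fun P Ps => hs P (or_intror Ps)).
    have [phi [qp _] <-] := hs P (or_introl erefl).
    exists (F `|` [set phi]); split; first by rewrite finite_setU.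
      by move=> x [/Fq//|->].
    move=> a ha R [<-|Rs]; first exact: (ha phi (or_intror erefl)).
    by apply: (hF a _ R Rs) => x Fx; apply: (ha x (or_introl Fx)).
  have [_ cq _] := gq; have [a ha] := cq F fF Fq.
  by exists a => P; apply: (hF a ha).
- exists c => phi qp; apply: (hc (fun a => sat U a phi)).
  by exists phi.
Qed.

Lemma invariantP M q s phi : invariant U M q -> automorphism U s -> fixes M s ->
  q (inst s phi) <-> q phi.
Proof.
move=> iq sA sM; split=> [qp|qp]; last by rewrite -(iq s sA sM); exists phi.
have [s' [s'A sK s'K]] := auto_inv sA.
rewrite -(iq s' s'A (fixes_inv sK sM)); exists (inst s phi) => //.
rewrite /inst fmap_comp -[RHS]fmap_id; congr fmap.
by apply/funext => -[] //= d; rewrite sK.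
Qed.

Lemma realizes_auto M q B (c : Y -> D) s : invariant U M q ->
  automorphism U s -> fixes M s ->
  realizes U c (q `&` over B) -> realizes U (s \o c) (q `&` over (s @` B)).
Proof.
move=> iq sA sM hc phi [qp [th _ eth]].
have [s' [s'A sK s'K]] := auto_inv sA.
have e : inst s (inst s' phi) = phi.
  rewrite /inst fmap_comp -[RHS]fmap_id; congr fmap.
  by apply/funext => -[] //= d; rewrite s'K.
rewrite -e sat_inst_auto //; apply: hc; split.
  by apply/(invariantP _ iq sA sM); rewrite e.
have s'B (b : (s @` B)) : B (s' (val b)).
  by case: b => b /= /set_mem[d Bd <-]; rewrite sK.
exists (inst (fun b => exist _ (s' (val b)) (mem_set (s'B b)) : B) th) => //.
by rewrite -eth /inst !fmap_comp; congr fmap; apply/funext => -[].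
Qed.

(** Finite Morley sequences, as lists. The base grows with the recursion, so that
    concatenation of chains is concatenation of lists ([chain_cat]). *)
Fixpoint chain q B cs : Prop :=
  match cs with
  | [::] => True
  | c :: cs' => realizes U c (q `&` over B) /\ chain q (B `|` range c) cs'
  end.

Definition entries cs : set D := [set d | exists2 c, List.In c cs & range c d].

Lemma entries_cons c cs : entries (c :: cs) = range c `|` entries cs.
Proof.
apply/seteqP; split=> [d [c' [<-|h] hd]|d [hd|[c' h hd]]].
- by left.
- by right; exists c'.
- by exists c => //; left.
- by exists c' => //; right.
Qed.

Lemma entries_nil : entries [::] = set0.
Proof. by apply/seteqP; split=> // d []. Qed.

Lemma chain_cat q B cs ds :
  chain q B (cs ++ ds) <-> chain q B cs /\ chain q (B `|` entries cs) ds.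
Proof.
elim: cs B => [|c cs IH] B /=; first by rewrite entries_nil setU0; split=> [|[]].
by rewrite IH entries_cons setUA; tauto.
Qed.

Lemma chain_subset q B B' cs : B `<=` B' -> chain q B' cs -> chain q B cs.
Proof.
elim: cs B B' => //= c cs IH B B' BB' [hc hcs]; split.
  exact: realizes_subset hc.
by apply: IH hcs; apply: setSU.
Qed.

Lemma small_entries cs : small K (entries cs).
Proof.
elim: cs => [|c cs IH].
  by rewrite entries_nil; exact: small_set0.
rewrite entries_cons; apply: small_setU => //.
exact: small_image.
Qed.

Lemma chain_ex q B n : global_type U q -> small K B ->
  exists2 cs, size cs = n & chain q B cs.
Proof.
move=> gq; elim: n B => [|n IH] B sB; first by exists [::].
have [c hc] := realizes_ex gq sB.
have [|cs <- hcs] := IH (B `|` range c); first exact: small_setU_range.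
by exists (c :: cs).
Qed.

Lemma image_setU_range (s : D -> D) B (c : Y -> D) :
  s @` (B `|` range c) = s @` B `|` range (s \o c).
Proof. by rewrite image_setU image_comp. Qed.

Lemma chain_auto M q B cs s : invariant U M q -> automorphism U s -> fixes M s ->
  chain q B cs -> chain q (s @` B) [seq s \o c | c <- cs].
Proof.
move=> iq sA sM; elim: cs B => //= c cs IH B [hc hcs]; split.
  exact: (realizes_auto iq sA sM hc).
by rewrite -image_setU_range; apply: IH.
Qed.

(** Two realizations of [q] over a small set are conjugate over it, and an
    automorphism over [M] carries realizations of the [M]-invariant type [q] to
    realizations of [q]; so [s] can be corrected one entry at a time. *)
Lemma chain_conj M q B cs cs' s :
  global_type U q -> invariant U M q -> small K B -> M `<=` B ->
  automorphism U s -> fixes M s ->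
  chain q B cs -> chain q (s @` B) cs' -> size cs = size cs' ->
  exists t, [/\ automorphism U t, {in B, t =1 s} & cs' = [seq t \o c | c <- cs]].
Proof.
move=> gq iq + + sA; elim: cs cs' B s sA => [|c cs IH] [|c' cs'] //= B s sA sB MB sM.
  by move=> _ _ _; exists s.
move=> [hc hcs] [hc' hcs'] [esz].
have [|r [rA rB er]] := realizes_conj gq _ (realizes_auto iq sA sM hc) hc'.
  exact: small_image.
have rs b : B b -> r (s b) = s b by move=> Bb; apply: rB; exists b.
have rsM : fixes M (r \o s) by move=> m Mm /=; rewrite rs ?sM //; apply: MB.
have e : (r \o s) @` (B `|` range c) = s @` B `|` range c'.
  rewrite image_setU_range -er; congr (_ `|` _).
  by apply/seteqP; split=> _ [b Bb <-]; exists b => //=; rewrite rs.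
rewrite -e in hcs'.
have [||t [tA tB et]] := IH _ _ _ (auto_comp rA sA) _ _ rsM hcs hcs' esz.
- exact: small_setU_range.
- by move=> m /MB; left.
exists t; split=> //.
  move=> b bB; rewrite tB /= ?rs //; first exact: set_mem.
  by apply/mem_set; left; apply: set_mem.
rewrite -et -er; congr (_ :: _); apply/funext => y /=.
by rewrite tB //; apply/mem_set; right; exists y.
Qed.

(** Joint satisfiability of finitely many instances: what [consistent] amounts to
    for them, without the detour through finite subsets. *)
Definition conf (X : Type) (phi : form L (X + Y)) cs : Prop :=
  exists x : X -> D, forall c, List.In c cs -> holds U (tuple_cat x c) phi.

Lemma conf_sub (X : Type) (phi : form L (X + Y)) cs ds :
  (forall c, List.In c cs -> List.In c ds) -> conf phi ds -> conf phi cs.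
Proof. by move=> h [x hx]; exists x => c /h/hx. Qed.

Lemma conf_auto (X : Type) (phi : form L (X + Y)) cs s : automorphism U s ->
  conf phi [seq s \o c | c <- cs] <-> conf phi cs.
Proof.
move=> sA; split=> -[x hx].
  have [s' [s'A sK s'K]] := auto_inv sA; exists (s' \o x) => c hc.
  rewrite -(auto_holds _ _ sA) (_ : _ \o _ = tuple_cat x (s \o c)).
    by apply: hx; apply/In_map; exists c.
  by apply/funext => -[] //= z; rewrite s'K.
exists (s \o x) => _ /In_map[c hc <-].
rewrite (_ : tuple_cat _ _ = s \o tuple_cat x c) ?auto_holds //; first exact: hx.
by apply/funext => -[].
Qed.

End Chains.

(** * Coheirs *)

Section Coheirs.
Context (L : language) (D : Type) (U : structure L D).

(** Elementarity is given for formulas in finitely many variables ['I_n]. *)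
Lemma elementary_holds (M : set D) (N : structure L M) :
  (forall (n : nat) (p : form L 'I_n) (v : 'I_n -> M),
     holds N v p <-> holds U (fun i => val (v i)) p) ->
  forall (V : Type) (p : form L V) (v : V -> M),
    holds N v p <-> holds U (fun i => val (v i)) p.
Proof.
move=> hN V p v.
have [n [g [p' e]]] := fin_right (fmap (@inr void V) p).
pose k W (w : void + W) : W := match w with inl e => of_void W e | inr w => w end.
have -> : p = fmap g (fmap (k _) p').
  have := congr1 (fmap (k _)) e; rewrite !fmap_comp => e'.
  by rewrite -[LHS]fmap_id -[RHS]/(fmap _ p') -e'; congr fmap; apply/funext => -[].
by rewrite !holds_fmap; have := hN n (fmap (k _) p') (v \o g); rewrite !holds_fmap.
Qed.

Lemma tarski_vaught (M : set D) (X : Type) (p : form L (X + M)) (a : X -> D) :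
  elementary U M -> holds U (tuple_cat a (fun c : M => val c)) p ->
  exists m : X -> M,
    holds U (tuple_cat (fun x => val (m x)) (fun c : M => val c)) p.
Proof.
move=> [N /elementary_holds hN] ha; have [psi hpsi] := ex_tuple p.
have : holds U (fun c : M => val c) psi by apply/hpsi; exists a.
move=> /(hN _ psi id)/hpsi[m /hN hm]; exists m.
by move: hm; congr (holds U _ p); apply/funext => -[].
Qed.

Lemma invariant_sub (X : Type) (M : set D) (q : set (form L (X + D))) :
  (forall s phi, automorphism U s -> fixes M s -> q phi -> q (inst s phi)) ->
  invariant U M q.
Proof.
move=> h s sA sM; have [s' [s'A sK s'K]] := auto_inv sA.
apply/seteqP; split=> [_ [phi qp <-]|phi qp]; first exact: h.
exists (inst s' phi); first by apply: h => //; exact: fixes_inv sM.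
rewrite /inst fmap_comp -[RHS]fmap_id; congr fmap.
by apply/funext => -[] //= d; rewrite s'K.
Qed.

(** A type over an elementary substructure [M] is finitely satisfiable in [M],
    hence contained in an ultrafilter on the tuples of [M]; the formulas true
    along the ultrafilter form a global type, which is invariant because
    automorphisms over [M] fix those tuples. *)
Lemma coheir_ex (M : set D) (Y : Type) (b : Y -> D) : elementary U M ->
  exists q, [/\ global_type U q, invariant U M q & tp U b M `<=` q].
Proof.
move=> eM; pose ev (phi : form L (Y + D)) : set (Y -> M) :=
  [set m | sat U (fun y => val (m y)) phi].
have [s hs|G [UG QG]] := @ultrafilter_fip _ (ev @` tp U b M).
  have [th [hth hs']] : exists th : form L (Y + M),
      holds U (tuple_cat b (fun c : M => val c)) th /\
      forall m : Y -> M,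
        holds U (tuple_cat (fun y => val (m y)) (fun c : M => val c)) th ->
        forall A, List.In A s -> A m.
    elim: s hs => [|A s IH] hs.
      exists (fNot fFalse); split=> [|m _ A []]; by rewrite holds_fNot.
    have [th [h1 h2]] := IH (fun A As => hs A (or_intror As)).
    have [phi [[th' _ <-] bphi] eA] := hs A (or_introl erefl).
    rewrite sat_inst in bphi.
    exists (fNot (fImp th (fNot th'))); split=> [/(_ h1)/(_ bphi)//|m hm B].
    move: hm => /not_implyP[m1 /contrapT m2].
    by case=> [<-|]; [rewrite -eA /ev /= sat_inst | apply: h2].
  have [m hm] := tarski_vaught eM hth; by exists m; apply: hs'.
have GP : ProperFilter G by exact: ultra_proper.
exists [set phi | G (ev phi)]; split.
- split=> [phi _|F fF Fq|phi _]; first exact: over_setT.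
    have [s es] := finite_listP fF.
    suff: G (fun m => forall phi, List.In phi s -> ev phi m).
      move=> /filter_ex[m hm]; exists (fun y => val (m y)) => phi /es.
      exact: hm.
    have {fF Fq es} : forall phi, List.In phi s -> G (ev phi) by move=> phi /es/Fq.
    elim: s => [|phi s IH] h; first by apply: filterS filterT.
    have Gs := IH (fun x xs => h x (or_intror xs)).
    by apply: filterS (filterI (h phi (or_introl erefl)) Gs) => m [m1 m2] x [<-|/m2].
  by have [?|?] := in_ultra_setVsetC (ev phi) UG; [left|right].
- apply: invariant_sub => s phi sA sM.
  apply: filterS => m hm; rewrite /ev /= -(sat_inst_auto _ _ sA) in hm.
  rewrite /ev /= (_ : (fun y => _) = s \o (fun y => val (m y))) //.
  by apply/funext => y /=; rewrite sM //; apply: set_mem (valP (m y)).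
- by move=> phi hphi; apply: QG; exists phi.
Qed.

Section Pullback.
Context (Y Y' : Type) (f : Y' -> Y) (q : set (form L (Y + D))).

(** The restriction of [q] to the coordinates [f], a subtuple of [Y]. *)
Definition pullback : set (form L (Y' + D)) :=
  [set phi | q (fmap (sum_map f id) phi)].

Lemma sat_fmap (a : Y -> D) (phi : form L (Y' + D)) :
  sat U a (fmap (sum_map f id) phi) = sat U (a \o f) phi.
Proof. by rewrite !satE holds_fmap tuple_cat_map. Qed.

Lemma inst_fmap (Z : Type) (b : Z -> D) (phi : form L (Y' + Z)) :
  fmap (sum_map f id) (inst b phi) = inst b (fmap (sum_map f id) phi).
Proof. by rewrite /inst !fmap_comp; congr fmap; apply/funext => -[]. Qed.

Lemma over_fmap (B : set D) (phi : form L (Y' + D)) :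
  over B phi -> over B (fmap (sum_map f id) phi).
Proof. by case=> th _ <-; exists (fmap (sum_map f id) th); rewrite ?inst_fmap. Qed.

Lemma pullback_global : global_type U q -> global_type U pullback.
Proof.
move=> [_ cq tq]; split=> [phi _|F fF Fq|phi _]; first exact: over_setT.
  have [_ [phi Fphi <-]|a ha] := cq (fmap (sum_map f id) @` F) (finite_image _ fF).
    exact: Fq.
  exists (a \o f) => phi Fphi; rewrite -sat_fmap; apply: ha.
  by exists phi.
exact: tq (over_setT _).
Qed.

Lemma pullback_invariant (M : set D) : invariant U M q -> invariant U M pullback.
Proof.
move=> iq; apply: invariant_sub => s phi sA sM qp.
by rewrite /pullback /= inst_fmap; apply/(invariantP _ iq sA sM).
Qed.

Lemma pullback_tp (M : set D) (b : Y -> D) :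
  tp U b M `<=` q -> tp U (b \o f) M `<=` pullback.
Proof.
move=> h phi [op sp]; apply: h; split; first exact: over_fmap.
by rewrite sat_fmap.
Qed.

Lemma pullback_realizes (B : set D) (c : Y -> D) :
  realizes U c (q `&` over B) -> realizes U (c \o f) (pullback `&` over B).
Proof.
move=> hc phi [qp op]; rewrite -sat_fmap; apply: hc; split=> //.
exact: over_fmap.
Qed.

Lemma pullback_chain (B : set D) (cs : seq (Y -> D)) :
  chain U q B cs -> chain U pullback B [seq c \o f | c <- cs].
Proof.
elim: cs B => //= c cs IH B [hc hcs]; split; first exact: pullback_realizes.
apply: IH; apply: chain_subset hcs => d [Bd|[y _ <-]]; first by left.
by right; exists (f y).
Qed.

End Pullback.

Lemma chain_mask (Y : Type) (q : set (form L (Y + D))) (B : set D)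
    (cs : seq (Y -> D)) (m : bitseq) : chain U q B cs -> chain U q B (mask m cs).
Proof.
elim: cs B m => [|c cs IH] B [|[] m] //= [hc hcs]; first by split=> //; apply: IH.
by apply: IH; apply: chain_subset hcs => d; left.
Qed.

End Coheirs.

(** * Kim-dividing along chains *)

Section KimDividing.
Context (L : language) (K D : Type) (U : structure L D) (slK : strong_limit K).
Context (satU : saturated K U) (homU : strongly_homogeneous K U).

Lemma entries_mkseq (Y : Type) (b : nat -> Y -> D) (n : nat) :
  entries (mkseq b n) = \bigcup_(j in [set j | (j < n)%O]) range (b j).
Proof.
apply/seteqP; split=> [d [c /In_map[j /In_mem js <-] hd]|d [j jn hd]].
  by exists j => //; move: js; rewrite mem_iota.
exists (b j) => //; apply/In_map; exists j => //; apply/In_mem.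
by rewrite mem_iota.
Qed.

Lemma morley_chain (Y : Type) (q : set (form L (Y + D))) (M : set D)
    (b : nat -> Y -> D) :
  morley_seq U M q b <-> forall n, chain U q M (mkseq b n).
Proof.
split=> [h|h n].
  elim=> // n IH; rewrite mkseqS -cats1; apply/chain_cat.
  by split=> //=; split=> //; rewrite entries_mkseq; exact: h.
have := h n.+1; rewrite mkseqS -cats1 => /chain_cat[_ []].
by rewrite entries_mkseq.
Qed.

Lemma morley_ex (Y : Type) (q : set (form L (Y + D))) (M : set D) :
  small K [set: Y] -> small K M -> global_type U q ->
  exists b : nat -> Y -> D, morley_seq U M q b.
Proof.
move=> sY sM gq.
have /choice[next hnext] : forall cs : seq (Y -> D), exists c,
    realizes U c (q `&` over (M `|` entries cs)).
  move=> cs; apply: (realizes_ex slK satU sY) => //.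
  by apply: small_setU => //; exact: small_entries.
pose l n := iter n (fun cs => rcons cs (next cs)) [::].
exists (fun n => next (l n)); apply/morley_chain => n.
have -> : mkseq (fun n => next (l n)) n = l n.
  by elim: n => // n IH; rewrite mkseqS IH.
elim: n => // n IH; rewrite /= -cats1; apply/chain_cat.
by split=> //; split=> //; exact: hnext.
Qed.

Section OverM.
Context (M : set D) (sM : small K M).

Lemma chain_conf (Y X : Type) (q : set (form L (Y + D))) (phi : form L (X + Y))
    (cs cs' : seq (Y -> D)) : small K [set: Y] ->
  global_type U q -> invariant U M q -> chain U q M cs -> chain U q M cs' ->
  size cs = size cs' -> conf U phi cs -> conf U phi cs'.
Proof.
move=> sY gq iq hcs; rewrite -[M in chain _ _ M]image_id => hcs' esz.
have [//|//|t [tA _ ->]] := chain_conj slK homU sY gq iq sM _ (auto_id U) _ hcs hcs' esz.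
by move/(conf_auto _ _ tA).
Qed.

Lemma finite_mkseq_bound (A : Type) (g : nat -> A) (F : set A) :
  finite_set F -> F `<=` range g ->
  exists k, forall x, F x -> exists2 i, i < k & g i = x.
Proof.
move=> /finite_listP[s es] Fg.
have : forall x, List.In x s -> range g x by move=> x /es/Fg.
have -> : F = [set x | List.In x s] by apply/seteqP; split=> x /es.
elim: s {es} => [|x s IH] h; first by exists 0.
have [k hk] := IH (fun y ys => h y (or_intror ys)).
have [i _ ei] := h x (or_introl erefl).
exists (maxn k i.+1) => y [<-|/hk[j jk ej]].
  by exists i => //; rewrite leq_max leqnn orbT.
by exists j => //; rewrite leq_max jk.
Qed.

Lemma morley_consistent (Y X : Type) (phi : form L (X + Y)) (b : nat -> Y -> D) :
  consistent U [set inst (b i) phi | i in [set: nat]] <->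
  forall k, conf U phi (mkseq b k).
Proof.
split=> [h k|h F fF Fb].
  have [||x hx] := h [set inst (b i) phi | i in [set i | (i < k)%N]].
  - by apply: finite_image; exact: finite_II.
  - by move=> _ [i _ <-]; exists i.
  exists x => _ /In_map[i /In_mem ik <-]; rewrite -sat_inst; apply: hx.
  by exists i => //; move: ik; rewrite mem_iota.
have [k hk] := finite_mkseq_bound fF Fb; have [x hx] := h k.
exists x => _ /hk[i ik <-]; rewrite sat_inst; apply: hx; apply/In_map.
by exists i => //; apply/In_mem; rewrite mem_iota.
Qed.

Lemma small_ord (n : nat) : small K [set: 'I_n].
Proof. exact: small_countType. Qed.

(** Morley sequences of a fixed length in an invariant type are conjugate over
    [M], so dividing along one of them is dividing along all, and by
    compactness it is witnessed at a finite length. *)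
Lemma kim_dividesP (X : Type) (n : nat) (phi : form L (X + 'I_n)) (b : 'I_n -> D) :
  kim_divides U M phi b <->
  exists q, [/\ global_type U q, invariant U M q, tp U b M `<=` q &
    exists k, forall cs, chain U q M cs -> size cs = k -> ~ conf U phi cs].
Proof.
split=> [[q [gq iq bq h]]|[q [gq iq bq [k hk]]]]; exists q; split=> //.
  have [c hc] := morley_ex (small_ord n) sM gq.
  have /morley_consistent/existsNP[k hk] := h _ hc; exists k => cs hcs sz cf.
  apply: hk; apply: (chain_conf (small_ord n) gq iq hcs _ _ cf).
    by move/morley_chain: hc.
  by rewrite size_mkseq.
move=> c hc /morley_consistent/(_ k); apply: hk; last by rewrite size_mkseq.
by move/morley_chain: hc.
Qed.

Lemma not_kim_divides_conf (X : Type) (n : nat) (phi : form L (X + 'I_n))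
    (b : 'I_n -> D) q cs :
  ~ kim_divides U M phi b -> global_type U q -> invariant U M q ->
  tp U b M `<=` q -> chain U q M cs -> conf U phi cs.
Proof.
move=> nk gq iq bq hcs; apply: contrapT => nc; apply/nk/kim_dividesP.
exists q; split=> //; exists (size cs) => ds hds esz cf.
exact/nc/(chain_conf (small_ord n) gq iq hds hcs esz cf).
Qed.

End OverM.
End KimDividing.

(** * Kim's lemma *)

Section Trees.
Context (L : language) (K D : Type) (U : structure L D) (slK : strong_limit K).
Context (satU : saturated K U) (homU : strongly_homogeneous K U).

Lemma dfn_set0 (X : Type) (P : (X -> D) -> Prop) : dfn U set0 P ->
  exists psi : form L X, forall a, holds U a psi <-> P a.
Proof.
move=> [th h]; pose f (w : X + (set0 : set D)) : X := match w with
  | inl i => i | inr e => match set_mem (valP e) with end end.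
exists (fmap f th) => a; rewrite holds_fmap -h.
rewrite (_ : a \o f = tuple_cat a (fun b : (set0 : set D) => val b)) //.
by apply/funext => -[x|[x hx]] //; case: (set_mem hx).
Qed.

(** The definition of SOP1 cut off at height [h], where it becomes a first-order
    condition on [a]. *)
Definition SOP1_tree (n m : nat) (Phi : form L ('I_n + 'I_m)) (h : nat)
    (a : seq bool -> 'I_m -> D) : Prop :=
  (forall eta, size eta <= h -> exists x, forall k, k <= size eta ->
     holds U (tuple_cat x (a (take k eta))) Phi) /\
  (forall nu eta, prefix (rcons nu false) eta -> size eta <= h ->
     ~ exists x, holds U (tuple_cat x (a eta)) Phi /\
                 holds U (tuple_cat x (a (rcons nu true))) Phi).

(** All formulas true of every tree of some height [h] are finitely satisfiable
    together, and a realization is a tree of infinite height. *)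
Lemma SOP1_of_finite_trees (n m : nat) (Phi : form L ('I_n + 'I_m)) :
  (forall h, exists a, SOP1_tree Phi h a) -> has_SOP1 U Phi.
Proof.
move=> fin.
pose tree (a : seq bool * 'I_m -> D) eta i := a (eta, i).
have dnode eta : dfn U set0 (fun w : 'I_n + seq bool * 'I_m -> D =>
    holds U (tuple_cat (w \o inl) (tree (w \o inr) eta)) Phi).
  pose f (w : 'I_n + 'I_m) : 'I_n + seq bool * 'I_m := match w with
    | inl i => inl i | inr j => inr (eta, j) end.
  apply: dfn_iff (dfn_comp f (dfn_holds U set0 Phi)) => w.
  by rewrite (_ : w \o f = tuple_cat (w \o inl) (tree (w \o inr) eta)) //;
    apply/funext => -[].
have [P [] //|s hs|a ha] := @compactness L D U K _ set0
  [set P | dfn U set0 P /\ exists h, forall a : seq bool * 'I_m -> D,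
     SOP1_tree Phi h (tree a) -> P a] slK satU (small_countType slK _) (small_set0 slK D).
- have [h hh] : exists h, forall P, List.In P s ->
      forall a, SOP1_tree Phi h (tree a) -> P a.
    elim: s hs => [|P s IH] hs; first by exists 0.
    have [h hh] := IH (fun P Ps => hs P (or_intror Ps)).
    have [_ [h' hh']] := hs P (or_introl erefl).
    exists (maxn h h') => R Rs a [t1 t2].
    have le k : k <= maxn h h' -> SOP1_tree Phi k (tree a).
      by move=> kh; split=> [eta ek|nu eta p ek]; [apply: t1|apply: t2];
        rewrite ?(leq_trans ek).
    by case: Rs => [<-|Rs]; [apply/hh'/le|apply: hh Rs _ _; apply: le];
      rewrite leq_max leqnn ?orbT.
  have [t ht] := fin h; exists (fun p => t p.1 p.2) => P Ps.
  exact: hh Ps _ ht.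
have pos eta : exists x, forall k, k <= size eta ->
    holds U (tuple_cat x (tree a (take k eta))) Phi.
  apply: (ha (fun a => exists x, forall k, k <= size eta ->
    holds U (tuple_cat x (tree a (take k eta))) Phi)).
  split; last by exists (size eta) => a' [+ _]; apply.
  apply: dfn_iff (dfn_ex (dfn_forall_In (s := iota 0 (size eta).+1)
    (fun k _ => dnode (take k eta)))) => a'.
  by split=> -[x hx]; exists x => k; [move=> hk | move=> /In_mem hk]; apply: hx;
    [apply/In_mem; rewrite mem_iota | move: hk; rewrite mem_iota].
have neg nu eta : prefix (rcons nu false) eta ->
    ~ exists x, holds U (tuple_cat x (tree a eta)) Phi /\
                holds U (tuple_cat x (tree a (rcons nu true))) Phi.
  move=> pr; apply: (ha (fun a => ~ exists x, holds U (tuple_cat x (tree a eta)) Phi /\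
                holds U (tuple_cat x (tree a (rcons nu true))) Phi)).
  split; last by exists (size eta) => a' [_ h]; apply: h.
  exact: dfn_not (dfn_ex (dfn_and (dnode eta) (dnode (rcons nu true)))).
exists (tree a); split=> [eta F fF hF|nu eta pr cons].
  have [N hN] := finite_mkseq_bound fF hF.
  have [x hx] := pos (mkseq eta N); exists x => _ /hN[i iN <-].
  rewrite sat_inst; have := hx i; rewrite size_mkseq => /(_ (ltnW iN)).
  by rewrite -map_take take_iota (minn_idPl (ltnW iN)).
apply: (neg nu eta pr).
have [//|//|x hx] := cons [set inst (tree a eta) Phi; inst (tree a (rcons nu true)) Phi].
by exists x; rewrite -!sat_inst; split; apply: hx; [left|right].
Qed.


(** Deepest first: the trees below are built from the leaves to the root, so that
    a branch read in this order is a Morley sequence. *)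
Fixpoint branch (A : Type) (t : seq bool -> seq A) (eta : seq bool) : seq A :=
  match eta with
  | [::] => [::]
  | b :: eta' => branch (fun xi => t (b :: xi)) eta' ++ t [:: b]
  end.

Lemma branch_ext (A : Type) (t u : seq bool -> seq A) eta :
  (forall b xi, t (b :: xi) = u (b :: xi)) -> branch t eta = branch u eta.
Proof.
by elim: eta t u => //= b eta IH t u e; rewrite e; congr (_ ++ _); apply: IH.
Qed.

Lemma branch_map (A B : Type) (f : A -> B) (t : seq bool -> seq A) eta :
  branch (fun xi => map f (t xi)) eta = map f (branch t eta).
Proof.
by elim: eta t => //= b eta IH t; rewrite map_cat (IH (fun xi => t (b :: xi))).
Qed.

Lemma In_branch (A : Type) (t : seq bool -> seq A) eta c :
  List.In c (branch t eta) -> exists xi, List.In c (t xi).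
Proof.
elim: eta t => //= b eta IH t /In_cat[/IH[xi h]|h]; first by exists (b :: xi).
by exists [:: b].
Qed.

Lemma branch_In (A : Type) (t : seq bool -> seq A) eta k c : k < size eta ->
  List.In c (t (take k.+1 eta)) -> List.In c (branch t eta).
Proof.
elim: eta t k => //= b eta IH t [|k] hk hc; apply/In_cat.
  by right; rewrite take0 in hc.
by left; apply: IH hk hc.
Qed.

Definition tree_set (n : nat) (t : seq bool -> seq ('I_n -> D)) : set D :=
  \bigcup_eta entries (t eta).

Lemma small_tree_set n (t : seq bool -> seq ('I_n -> D)) : small K (tree_set t).
Proof.
have [d0] := s_inh U; pose c0 : 'I_n -> D := fun=> d0.
have := small_image (fun p : seq bool * nat * 'I_n => nth c0 (t p.1.1) p.1.2 p.2)
  (small_countType slK _).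
apply: small_subset => d [eta _ [c /(In_nthP c0)[i _ <-] [j _ <-]]].
by exists (eta, i, j).
Qed.

Lemma entries_map n (s : D -> D) (cs : seq ('I_n -> D)) :
  entries [seq s \o c | c <- cs] = s @` entries cs.
Proof.
apply/seteqP; split=> [_ [_ /In_map[c hc <-] [i _ <-]]|_ [_ [c hc [i _ <-]] <-]].
  by exists (c i) => //; exists c.
by exists (s \o c); [apply/In_map; exists c | exists i].
Qed.

Section TwoTypes.
Context (M : set D) (sM : small K M) (n : nat) (b : 'I_n -> D).
Context (q r : set (form L ('I_n + D))).
Context (gq : global_type U q) (iq : invariant U M q) (bq : tp U b M `<=` q).
Context (gr : global_type U r) (ir : invariant U M r) (br : tp U b M `<=` r).

Let sn : small K [set: 'I_n] := small_ord slK n.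

Lemma image_fixes (s : D -> D) : fixes M s -> s @` M = M.
Proof.
move=> hs; apply/seteqP; split=> [_ [m Mm <-]|m Mm]; first by rewrite hs.
by exists m; rewrite ?hs.
Qed.

Lemma chain_fixes (p : set (form L ('I_n + D))) s (cs : seq ('I_n -> D)) :
  invariant U M p -> automorphism U s -> fixes M s ->
  chain U p M cs -> chain U p M [seq s \o c | c <- cs].
Proof. by move=> ip sA hs /(chain_auto ip sA hs); rewrite image_fixes. Qed.

(** Both [q] and [r] restrict to [tp(b/M)]. *)
Lemma realizes_M_swap (e : 'I_n -> D) :
  realizes U e (q `&` over M) -> realizes U e (r `&` over M).
Proof.
move=> he phi [rphi ophi]; have [sb|sb] := pselect (sat U b phi).
  by apply: he; split=> //; apply: bq.
have rn : r (fNot phi).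
  by apply: br; split=> //; case: ophi => th _ <-; exists (fNot th).
have [_ cr _] := gr.
have [||x hx] := cr [set phi; fNot phi].
- by rewrite finite_setU; split; exact: finite_set1.
- by move=> _ [->|->].
- by have := hx (fNot phi) (or_intror erefl) (hx phi (or_introl erefl)).
Qed.

(** The tree grows from the leaves to the root: a new block [cs] is chosen after
    (that is, free from) the tree [t] already built. On the right, [t] and [cs] are
    replaced by their images under an automorphism [s] over [M] which moves the
    first entry of [cs] to a realization [e] of [q] over everything on the
    left; such an automorphism exists as [q] and [r] agree over [M]. *)
Lemma tree_ex (N h : nat) : exists t : seq bool -> seq ('I_n -> D),
  [/\ forall eta, size eta = h -> chain U r M (branch t eta),
      forall eta, 0 < size eta <= h -> chain U r M (t eta) /\ size (t eta) = N.+1 &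
      forall nu eta, prefix (rcons nu false) eta -> size eta <= h ->
        exists2 e, List.In e (t (rcons nu true)) &
          realizes U e (q `&` over (M `|` entries (t eta)))].
Proof.
elim: h => [|h [t [t1 t2 t3]]].
  exists (fun=> [::]); split=> [[]//|eta|nu eta /prefixP[xi ->]].
    by case: eta.
  by rewrite size_cat size_rcons.
have sB : small K (M `|` tree_set t).
  by apply: small_setU => //; exact: small_tree_set.
have [cs szcs hcs] := chain_ex slK satU sn N.+1 gr sB.
have [|e he] := realizes_ex slK satU sn (B := M `|` tree_set t `|` entries cs) gq.
  by apply: small_setU => //; exact: small_entries.
have [s [sA sM' se]] : exists s, [/\ automorphism U s, fixes M s &
    exists2 c, List.In c cs & s \o c = e].
  case: cs szcs hcs he => // c cs _ [hc _] he.
  have [||s [sA sM' es]] := realizes_conj slK homU sn gr sM (c := c) (c' := e).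
  - by apply: realizes_subset hc; left.
  - by apply: realizes_M_swap; apply: realizes_subset he => m Mm; left; left.
  by exists s; split=> //; exists c => //; left.
pose u eta := if eta is [::] then cs else t eta.
pose t' eta := match eta with
  | [::] => [::]
  | false :: eta' => u eta' | true :: eta' => [seq s \o c | c <- u eta'] end.
have uE eta : branch u eta = branch t eta by apply: branch_ext.
have u1 eta : size eta = h -> chain U r M (branch u eta ++ cs).
  move=> /t1 h1; rewrite uE; apply/chain_cat; split=> //.
  apply: chain_subset hcs => d [Md|[c hc hd]]; first by left.
  by have [xi hxi] := In_branch hc; right; exists xi => //; exists c.
have u2 eta : size eta <= h -> chain U r M (u eta) /\ size (u eta) = N.+1.
  case: eta => [_|x eta he']; last by apply: t2.
  by split=> //; apply: chain_subset hcs; left.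
have u3 eta : realizes U e (q `&` over (M `|` entries (u eta))).
  apply: realizes_subset he => d [Md|hd]; first by left; left.
  case: eta hd => [hd|x eta hd]; first by right.
  by left; right; exists (x :: eta).
exists t'; split.
- move=> [|[] eta] //= [/u1 h1]; last by [].
  by rewrite branch_map -map_cat; apply: chain_fixes.
- move=> [|[] eta] //= /u2[h1 h2]; last by [].
  by rewrite size_map; split=> //; apply: chain_fixes.
- move=> [|x nu] [|y eta] //=.
    case: y => //= _ _; have [c hc ec] := se.
    exists e; last exact: u3.
    by apply/In_map; exists c.
  case/andP=> /eqP<- pr {}/(t3 _ _ pr)[e' he' re'].
  have eu : u eta = t eta by case: eta pr {re'} => //; case: nu {he'}.
  have eu' : u (rcons nu true) = t (rcons nu true) by case: nu {pr he'}.
  case: x => /=; rewrite eu eu'; last by exists e'.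
  exists (s \o e'); first by apply/In_map; exists e'.
  rewrite entries_map -{1}(image_fixes sM') -image_setU.
  exact: realizes_auto iq sA sM' re'.
Qed.

End TwoTypes.
End Trees.

Section InvariantTypes.
Context (L : language) (K D : Type) (U : structure L D) (slK : strong_limit K).
Context (satU : saturated K U) (homU : strongly_homogeneous K U).
Context (M : set D) (sM : small K M) (n : nat) (b : 'I_n -> D).
Context (q r : set (form L ('I_n + D))).
Context (gq : global_type U q) (iq : invariant U M q) (bq : tp U b M `<=` q).
Context (gr : global_type U r) (ir : invariant U M r) (br : tp U b M `<=` r).

Let sn : small K [set: 'I_n] := small_ord slK n.

Lemma mixed_chain_conj (cs zs cs' zs' : seq ('I_n -> D)) :
  chain U r M cs -> chain U q (M `|` entries cs) zs ->
  chain U r M cs' -> chain U q (M `|` entries cs') zs' ->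
  size cs = size cs' -> size zs = size zs' ->
  exists2 s, automorphism U s & cs' ++ zs' = [seq s \o c | c <- cs ++ zs].
Proof.
move=> hcs hzs hcs' hzs' ecs ezs.
rewrite -[M in chain _ _ M cs']image_id in hcs'.
have [//|//|s [sA sM' es]] := chain_conj slK homU sn gr ir sM _ (auto_id U) _ hcs hcs' ecs.
have fs : fixes M s by move=> m /mem_set/sM'.
rewrite es entries_map -{1}(image_fixes fs) -image_setU in hzs'.
have [||t [tA tB ->]] := chain_conj slK homU sn gq iq _ _ sA fs hzs hzs' ezs.
- by apply: small_setU => //; exact: small_entries.
- by move=> m; left.
exists t => //; rewrite es map_cat; congr (_ ++ _).
elim: cs {hcs hcs' ecs es hzs hzs'} tB => //= c cs IH tB; congr (_ :: _).
  apply/funext => i /=; rewrite tB //; apply/mem_set; right.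
  by exists c; [left | exists i].
apply: IH => x /set_mem[Mx|[c' hc' hx]]; apply: tB; apply/mem_set; first by left.
by right; exists c' => //; right.
Qed.

(** The conjunction of [p] instances of [phi], with its parameters reindexed by
    an ordinal as the definition of SOP1 requires. *)
Lemma all_conjuncts (l p : nat) (phi : form L ('I_l + 'I_n)) :
  exists Phi : form L ('I_l + 'I_(#|{: 'I_p * 'I_n}|)),
    forall x a, holds U (tuple_cat x a) Phi <->
      forall i : 'I_p, holds U (tuple_cat x (fun j => a (enum_rank (i, j)))) phi.
Proof.
pose P (i : 'I_p) (a : 'I_l + 'I_(#|{: 'I_p * 'I_n}|) -> D) :=
  holds U (tuple_cat (a \o inl) (fun j => a (inr (enum_rank (i, j))))) phi.
have dP i : dfn U set0 (P i).
  pose f (w : 'I_l + 'I_n) : 'I_l + 'I_(#|{: 'I_p * 'I_n}|) := match w with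
    | inl i => inl i | inr j => inr (enum_rank (i, j)) end.
  apply: dfn_iff (dfn_comp f (dfn_holds U set0 phi)) => a; rewrite /P.
  by rewrite (_ : a \o f = tuple_cat (a \o inl) (fun j => a (inr (enum_rank (i, j))))) //;
    apply/funext => -[].
have [Phi hPhi] := dfn_set0 (dfn_forall_fin dP).
by exists Phi => x a; rewrite hPhi.
Qed.

(** Let [m] be maximal such that every [r]-chain followed by [m] realizations
    of [q] is consistent. Some length [N] then makes an [r]-chain of length [N]
    followed by [m.+1] realizations of [q] inconsistent. Adding a fixed tail of
    [m] realizations of [q] over the tree to all its blocks, a block on the
    left becomes inconsistent with the right sibling of any of its prefixes,
    whereas branches are [r]-chains. *)
Lemma SOP1_of_invariant_types (l : nat) (phi : form L ('I_l + 'I_n)) :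
  (exists k, forall cs, chain U q M cs -> size cs = k -> ~ conf U phi cs) ->
  (forall cs, chain U r M cs -> conf U phi cs) ->
  exists (m : nat) (Phi : form L ('I_l + 'I_m)), has_SOP1 U Phi.
Proof.
move=> [k hk] hr.
pose P m := forall cs zs, chain U r M cs -> chain U q (M `|` entries cs) zs ->
  size zs = m -> conf U phi (cs ++ zs).
have [m [Pm nPm]] : exists m, P m /\ ~ P m.+1.
  apply: contrapT => no; have P0 : P 0.
    by move=> cs [|//] hcs _ _; rewrite cats0; exact: hr.
  have Pk : P k.
    by elim: (k) => // m Pm; apply: contrapT => nP; apply: no; exists m.
  have [zs ezs hzs] := chain_ex slK satU sn k gq sM.
  apply: (hk zs hzs ezs); apply: (Pk [::] zs) => //.
  by rewrite entries_nil setU0.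
have [cs0 [zs0 [hcs0 hzs0 ezs0 nc0]]] : exists cs zs, [/\ chain U r M cs,
    chain U q (M `|` entries cs) zs, size zs = m.+1 & ~ conf U phi (cs ++ zs)].
  apply: contrapT => no; apply: nPm => cs zs hcs hzs ezs; apply: contrapT => nc.
  by apply: no; exists cs, zs.
set N := size cs0.
(* Length [N.+1] instead of [N], so that a block is never empty. *)
have bad cs zs : chain U r M cs -> chain U q (M `|` entries cs) zs ->
    size cs = N.+1 -> size zs = m.+1 -> ~ conf U phi (cs ++ zs).
  case: cs => // c cs [_ hcs] hzs [ecs] ezs cf; apply: nc0.
  have hcs' : chain U r M cs by apply: chain_subset hcs; left.
  have hzs' : chain U q (M `|` entries cs) zs.
    apply: chain_subset hzs => d [Md|hd]; first by left.
    by rewrite entries_cons; right; right.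
  have [||s sA ->] := mixed_chain_conj hcs' hzs' hcs0 hzs0; rewrite ?ezs //.
  by apply/conf_auto => //; apply: conf_sub cf => d hd; right.
have [Phi hPhi] := all_conjuncts (N.+1 + m) phi.
exists _, Phi; apply: (SOP1_of_finite_trees slK satU) => h.
have [t [t1 t2 t3]] := tree_ex slK satU homU sM gq iq bq gr ir br N h.+1.
have sB : small K (M `|` tree_set t).
  by apply: small_setU => //; exact: (small_tree_set U slK).
have [zs ezs hzs] := chain_ex slK satU sn m gq sB.
have [d0] := s_inh U.
pose node eta := t (false :: eta) ++ zs.
pose c0 : 'I_n -> D := fun=> d0.
pose a eta (w : 'I_(#|{: 'I_(N.+1 + m) * 'I_n}|)) :=
  nth c0 (node eta) (enum_val w).1 (enum_val w).2.
have ha x eta : size eta <= h -> holds U (tuple_cat x (a eta)) Phi <->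
    forall c, List.In c (node eta) -> holds U (tuple_cat x c) phi.
  move=> he; have sz : size (node eta) = N.+1 + m.
    by rewrite size_cat ezs (t2 (false :: eta) he).2.
  have e i : (fun j => a eta (enum_rank (i, j))) = nth c0 (node eta) i.
    by apply/funext => j; rewrite /a enum_rankK.
  rewrite hPhi; split=> [H c|H i].
    move=> /(In_nthP c0)[i]; rewrite sz => hi <-.
    by have := H (Ordinal hi); rewrite e.
  by rewrite e; apply: H; apply: In_nth; rewrite sz.
(* The tree is used above [false], since the root of a tree also lies on its
   branches in the definition of SOP1, but carries no block in [t]. *)
exists a; split=> [eta he|nu eta pr he].
  pose eta' := (false :: eta) ++ nseq (h - size eta) false.
  have se' : size eta' = h.+1.
    by rewrite size_cat /= size_nseq addSn subnKC.
  have [|//|x hx] := Pm (branch t eta') zs (t1 _ se').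
    apply: chain_subset hzs => d [Md|[c hc hd]]; first by left.
    by have [xi hxi] := In_branch hc; right; exists xi => //; exists c.
  exists x => j hj; apply/ha; first by rewrite size_take_min (leq_trans (geq_minr _ _)).
  move=> c /In_cat[hc|hc]; apply: hx; apply/In_cat; last by right.
  left; apply: (@branch_In _ t eta' j); first by rewrite se' ltnS (leq_trans hj).
  rewrite /eta' /= take_cat; case: ltnP => // le.
  have ej : j = size eta by apply/eqP; rewrite eqn_leq hj.
  by rewrite ej subnn take0 cats0 -{1}[eta]take_size -ej.
have hnu : size (rcons nu true) <= h.
  by apply: leq_trans he; move/size_prefix: pr; rewrite !size_rcons.
move=> [x [/ha-/(_ he) x1 /ha-/(_ hnu) x2]].
have [|e he1 he2] := t3 (false :: nu) (false :: eta) _ he.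
  by rewrite rcons_cons /= pr.
have [tc ts] := t2 (false :: eta) he.
apply: (bad (t (false :: eta)) (e :: zs) tc) => //=; last 1 first.
- exists x => c /In_cat[hc|[<-|hc]].
  + by apply: x1; apply/In_cat; left.
  + by apply: x2; apply/In_cat; left.
  + by apply: x1; apply/In_cat; right.
- split=> //; apply: chain_subset hzs => d [[Md|hd]|[i _ <-]]; first by left.
    by right; exists (false :: eta).
  by right; exists (false :: rcons nu true) => //; exists e => //; exists i.
- by rewrite ezs.
Qed.

End InvariantTypes.

Section KimLemma.
Context (L : language) (K D : Type) (U : structure L D) (slK : strong_limit K).
Context (satU : saturated K U) (homU : strongly_homogeneous K U) (hN : NSOP1 U).
Context (M : set D) (sM : small K M).

(** Kim's lemma for Kim-dividing: in an NSOP1 structure one invariant type decides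
    for all. The definition of SOP1 asks for finitely many variables [x], hence
    the passage from [phi] to a formula in ['I_l]. *)
Theorem kim_lemma (X : Type) (n : nat) (phi : form L (X + 'I_n)) (b : 'I_n -> D)
    (r : set (form L ('I_n + D))) :
  kim_divides U M phi b -> global_type U r -> invariant U M r -> tp U b M `<=` r ->
  exists k, forall cs, chain U r M cs -> size cs = k -> ~ conf U phi cs.
Proof.
move=> /(kim_dividesP slK satU homU sM)[q [gq iq bq [k hk]]] gr ir br.
have [l [f [g e]]] := fin_left phi.
have cfE cs : conf U (fmap (sum_map f id) phi) cs <-> conf U phi cs.
  split=> -[x hx].
    by exists (x \o f) => c /hx; rewrite holds_fmap tuple_cat_map.
  exists (x \o g) => c /hx; rewrite -{1}e holds_fmap tuple_cat_map //.
apply: contrapT => no.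
have [||m [Phi]] := SOP1_of_invariant_types slK satU homU sM gq iq bq gr ir br
  (phi := fmap (sum_map f id) phi); last exact: hN.
- by exists k => cs hcs sz /cfE; apply: hk.
- move=> cs hcs; apply/cfE; apply: contrapT => nc; apply: no.
  exists (size cs) => ds hds sz cf; apply: nc.
  exact: (chain_conf slK homU sM (small_ord slK n) gr ir hds hcs sz cf).
Qed.

End KimLemma.

(** * Extension of Kim-independence, finitary form *)

Lemma pigeonhole (A : Type) (R : nat -> A -> Prop) (m k : nat) (ts : seq A) :
  (forall t, List.In t ts -> exists2 j, j < m & R j t) -> m * k < size ts ->
  exists2 j, j < m & k < size [seq t <- ts | `[< R j t >]].
Proof.
move=> hR lt; apply: contrapT => no.
have : size ts <= \sum_(j < m) size [seq t <- ts | `[< R j t >]].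
  elim: ts {lt no} hR => // t ts IH hR /=.
  have [j jm Rj] := hR t (or_introl erefl).
  have := IH (fun t ht => hR t (or_intror ht)).
  rewrite (bigD1 (Ordinal jm)) //= [X in _ -> _ < X](bigD1 (Ordinal jm)) //=.
  have /asboolP -> := Rj; rewrite /= addSn ltnS => /leq_trans; apply.
  by rewrite leq_add2l; apply: leq_sum => i _; case: ifP => _ //=.
apply/negP; rewrite -ltnNge; apply: leq_trans lt; rewrite ltnS.
rewrite -[m in m * k]card_ord -sum_nat_const; apply: leq_sum => j _.
by rewrite leqNgt; apply/negP => h; apply: no; exists j.
Qed.

Lemma In_filter (A : Type) (p : pred A) (s : seq A) x :
  List.In x [seq y <- s | p y] <-> List.In x s /\ p x.
Proof.
elim: s => [|y s IH] /=; first by split=> // -[].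
case: ifP => py /=; rewrite IH; split.
- by case=> [<-|[h1 h2]]; split=> //; [left | right].
- by case=> [[->|h1] h2]; [left | right].
- by case=> h1 h2; split=> //; right.
- by case=> [[e|h1] h2] //; move: py; rewrite e h2.
Qed.

Lemma In_flatten (A : Type) (ss : seq (seq A)) x :
  List.In x (flatten ss) <-> exists2 s, List.In s ss & List.In x s.
Proof.
elim: ss => [|s ss IH] /=; first by split=> // -[].
rewrite In_cat IH; split.
  by case=> [h|[t ht h]]; [exists s => //; left | exists t => //; right].
by case=> t [<-|ht] h; [left | right; exists t].
Qed.

Section Extension.
Context (L : language) (K D : Type) (U : structure L D) (slK : strong_limit K).
Context (satU : saturated K U) (homU : strongly_homogeneous K U) (hN : NSOP1 U).
Context (M : set D) (sM : small K M) (eM : elementary U M).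

(** A type Kim-divides as soon as it implies a Kim-dividing formula, whose
    parameters may lie outside the domain of the type; so it is these formulas
    [theta], rather than only the Kim-dividing ones, that have to be avoided. *)
Definition kim_implies (I : Type) (theta : form L (I + D)) : Prop :=
  exists (n : nat) (phi : form L (I + 'I_n)) (d : 'I_n -> D),
    (forall x, sat U x theta -> sat U x (inst d phi)) /\ kim_divides U M phi d.

Lemma kim_divides_auto (I : Type) (n : nat) (phi : form L (I + 'I_n))
    (d : 'I_n -> D) s : automorphism U s -> fixes M s ->
  kim_divides U M phi d -> kim_divides U M phi (s \o d).
Proof.
move=> sA hs [q [gq iq dq h]]; exists q; split=> // theta [[th _ <-]].
rewrite sat_inst holds_fixes // => hth; apply: dq; split; first by exists th.
by rewrite sat_inst.
Qed.

Lemma kim_implies_auto (I : Type) (theta : form L (I + D)) s :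
  automorphism U s -> fixes M s -> kim_implies theta -> kim_implies (inst s theta).
Proof.
move=> sA hs [n [phi [d [h kd]]]]; exists n, phi, (s \o d); split; last first.
  exact: kim_divides_auto.
have [s' [s'A sK s'K]] := auto_inv sA; move=> x.
have -> : x = s \o (s' \o x) by apply/funext => i /=; rewrite s'K.
rewrite sat_inst_auto // => /h; rewrite !sat_inst.
rewrite (_ : tuple_cat (s \o _) _ = s \o tuple_cat (s' \o x) d) ?auto_holds //.
by apply/funext => -[].
Qed.

Context (I J : Type) (a : I -> D) (b : J -> D) (hab : kim_indep U M a b).

Lemma not_kim_divides_tp (k : nat) (psi : form L (I + 'I_k)) (b' : 'I_k -> D) :
  range b' `<=` M `|` range b -> holds U (tuple_cat a b') psi ->
  ~ kim_divides U M psi b'.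
Proof.
move=> rb ha kd; apply: hab; exists k, psi, b'; split=> // x hx.
apply: hx; split; last by rewrite sat_inst.
pose g i : (M `|` range b : set D) := exist _ (b' i) (mem_set (rb _ (imageT b' i))).
by exists (fmap (sum_map id g) psi) => //; rewrite /inst fmap_comp; congr fmap;
  apply/funext => -[].
Qed.

(** Kim-forking equals Kim-dividing: if a formula [psi] of [tp(a/Mb)] implied a
    disjunction of formulas that Kim-divide, then along a Morley sequence in a
    coheir of the type of all parameters one disjunct would be satisfied, by a
    realization of the copies of [psi], on a long subsequence; Kim's lemma
    forbids this. *)
Theorem kim_extension_fin (psi : form L (I + D)) (s : seq (form L (I + D))) :
  over (M `|` range b) psi -> sat U a psi ->
  (forall theta, List.In theta s -> kim_implies theta) ->
  exists a', sat U a' psi /\ forall theta, List.In theta s -> ~ sat U a' theta.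
Proof.
case=> psi1 _ <- {psi}; have [k [g [psi <-]]] := fin_right psi1.
pose b' i := val (g i).
have rb : range b' `<=` M `|` range b by move=> _ [i _ <-]; apply: set_mem (valP (g i)).
have -> : inst (fun c => val c) (fmap (sum_map id g) psi) = inst b' psi.
  by rewrite /inst fmap_comp; congr fmap; apply/funext => -[].
rewrite sat_inst => ha hs; apply: contrapT => no.
have nkd := not_kim_divides_tp rb ha.
pose item := {n : nat & (form L (I + 'I_n) * ('I_n -> D))%type}.
have [items [hitems hcov]] : exists items : seq item,
    (forall it, List.In it items -> kim_divides U M (projT2 it).1 (projT2 it).2) /\
    forall theta, List.In theta s -> exists2 it, List.In it items &
      forall x, sat U x theta -> holds U (tuple_cat x (projT2 it).2) (projT2 it).1.
  elim: s hs {no} => [|theta s IH] hs; first by exists [::].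
  have [items [h1 h2]] := IH (fun th hth => hs th (or_intror hth)).
  have [n [phi [d [h3 h4]]]] := hs theta (or_introl erefl).
  exists (existT _ n (phi, d) :: items); split; first by move=> it [<-|/h1].
  move=> th [<-|/h2[it hit h]]; last by exists it => //; right.
  by exists (existT _ n (phi, d)); [left | move=> x /h3; rewrite sat_inst].
have [d0] := s_inh U.
pose it0 : item := existT _ 0 (fFalse, fun=> d0).
pose it j := nth it0 items j.
pose phi j := (projT2 (it j)).1; pose c j := (projT2 (it j)).2.
(* All parameters of [psi] and of the items, as one tuple; the index of the
   default value [d0] is never used. *)
pose tot (w : 'I_k + nat * nat) : D := match w with
  | inl i => b' i
  | inr (j, i) => if insub i is Some i' then c j i' else d0 end.
pose f j (i : 'I_(projT1 (it j))) : 'I_k + nat * nat := inr (j, val i).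
have cE j : c j = tot \o f j by apply/funext => i /=; rewrite valK.
have [r [gr ir tr]] := coheir_ex tot eM.
have sY : small K [set: 'I_k + nat * nat] := small_countType slK _.
set m := size items.
have /choice[kk hkk] : forall j, exists kj, j < m ->
    forall cs, chain U (pullback (@f j) r) M cs -> size cs = kj -> ~ conf U (phi j) cs.
  move=> j; have [jm|_] := boolP (j < m); last by exists 0.
  have [||||kj hkj] := kim_lemma slK satU homU hN sM (b := c j) (phi := phi j)
    (r := pullback (@f j) r).
  - by apply: hitems; apply: In_nth.
  - exact: pullback_global.
  - exact: pullback_invariant.
  - by rewrite cE; apply: pullback_tp.
  - by exists kj.
pose k0 := \max_(j < m) kk j.
have [ts szts hts] := chain_ex slK satU sY (m * k0).+1 gr sM.
have [x hx] : conf U psi [seq t \o inl | t <- ts].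
  apply: (not_kim_divides_conf slK satU homU sM nkd (q := pullback inl r)).
  - exact: pullback_global.
  - exact: pullback_invariant.
  - exact: (pullback_tp (f := inl) tr).
  - exact: pullback_chain.
pose R j t := holds U (tuple_cat x (t \o f j)) (phi j).
have tsM t : List.In t ts -> realizes U t (r `&` over M).
  elim: (ts) (M) hts => //= u us IH N [hu hus] [<-//|tu].
  by apply: realizes_subset (IH _ hus tu); left.
have totM : realizes U tot (r `&` over M).
  move=> theta [rt ot]; apply: contrapT => nt.
  have rn : r (fNot theta).
    by apply: tr; split=> //; case: ot => th _ <-; exists (fNot th).
  have [_ cr _] := gr.
  have [|_ [->|->]//|y hy] := cr [set theta; fNot theta].
    by rewrite finite_setU; split; exact: finite_set1.
  exact: hy (fNot theta) (or_intror erefl) (hy theta (or_introl erefl)).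
have [t ht||j jm] := @pigeonhole _ R m k0 ts.
- have [u [uA uM ut]] := realizes_conj slK homU sY gr sM totM (tsM t ht).
  have [u' [u'A uK u'K]] := auto_inv uA.
  have move_u Z (d : Z -> D) : tuple_cat x (u \o d) = u \o tuple_cat (u' \o x) d.
    by apply/funext => -[] //= i; rewrite u'K.
  have [th hth sth] : exists2 th, List.In th s & sat U (u' \o x) th.
    apply: contrapT => no'; apply: no; exists (u' \o x); split=> [|th hth sth].
      have e0 : tuple_cat x (t \o inl) = u \o tuple_cat (u' \o x) b'.
        by rewrite -move_u -ut.
      have := hx (t \o inl); rewrite e0 auto_holds // sat_inst; apply.
      by apply/In_map; exists t.
    by apply: no'; exists th.
  have [i hi hth'] := hcov _ hth; have [j jm ej] := In_nthP it0 hi.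
  exists j => //; rewrite /R -ut -compA -cE move_u auto_holds //.
  by have := hth' _ sth; rewrite -ej.
- by rewrite szts.
set ts' := [seq t <- ts | `[< R j t >]] => lt.
have kj : kk j <= size ts'.
  by apply: leq_trans (ltnW lt); rewrite (bigmax_sup (Ordinal jm)).
apply: (hkk j jm [seq t \o f j | t <- take (kk j) ts']).
- apply: pullback_chain; have : chain U r M ts'.
    by rewrite /ts' filter_mask; apply: chain_mask.
  by rewrite -{1}(cat_take_drop (kk j) ts') => /chain_cat[].
- by rewrite size_map size_takel.
- exists x => _ /In_map[t ht <-].
  suff /In_filter[_ /asboolP//] : List.In t ts'.
  by rewrite -(cat_take_drop (kk j) ts'); apply/In_cat; left.
Qed.

End Extension.

(** * Neumann's lemma and disjoint copies *)

(** If all elements of the finite set [es] have infinite orbits, some element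
    of the group moves [es] off a given finite set. Otherwise the group is
    covered by finitely many cosets of the stabilizers of the elements of [es];
    a translate of the stabilizer of [e] outside the cover is covered by cosets
    of the other stabilizers, hence so is the group, which is impossible
    by induction on [es]. *)
Lemma neumann (D : Type) (G : set (D -> D)) (es : seq D) :
  G id -> (forall g h, G g -> G h -> G (g \o h)) ->
  (forall g, G g -> exists g', [/\ G g', cancel g g' & cancel g' g]) ->
  (forall e, List.In e es ->
     forall F : seq D, exists2 g, G g & ~ List.In (g e) F) ->
  forall F : seq D, exists2 g, G g & forall e, List.In e es -> ~ List.In (g e) F.
Proof.
move=> G1 GM GV; elim: es => [|e es IH] inf F; first by exists id.
apply: contrapT => no.
have [h Gh hF] := inf e (or_introl erefl) F.
have [h' [Gh' hK h'K]] := GV h Gh.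
have cov g : G g -> exists2 e', List.In e' (e :: es) & List.In (g e') F.
  move=> Gg; apply: contrapT => no'; apply: no; exists g => // e' he' hF'.
  by apply: no'; exists e'.
have [F' hF'] : exists F' : seq D, forall g, G g -> List.In (g e) F ->
    exists2 e', List.In e' es & List.In (g e') F'.
  suff /(_ F) : forall F0 : seq D, exists F' : seq D, forall g, G g ->
      List.In (g e) F0 -> exists2 e', List.In e' es & List.In (g e') F' by [].
  elim=> [|x F0 [F' hF']]; first by exists [::].
  have [[k Gk kx]|nk] := pselect (exists2 k, G k & k e = x); last first.
    exists F' => g Gg [gx|]; last exact: hF'.
    by case: nk; exists g.
  have [k' [Gk' kK k'K]] := GV k Gk.
  exists ([seq k (h' y) | y <- F] ++ F') => g Gg [gx|]; last first.
    by move=> /(hF' g Gg)[e' ? ?]; exists e' => //; apply/In_cat; right.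
  have ge : h (k' (g e)) = h e by rewrite -gx -kx kK.
  have [e' [<-|he'] hF0] := cov (h \o k' \o g) (GM _ _ (GM _ _ Gh Gk') Gg).
    by rewrite /= ge in hF0.
  exists e' => //; apply/In_cat; left; apply/In_map.
  by exists (h (k' (g e'))) => //; rewrite hK k'K.
have [g Gg hg] := IH (fun e' he' => inf e' (or_intror he')) (F ++ F').
have [e' [<-|he'] geF] := cov g Gg.
  have [e'' he'' h2] := hF' g Gg geF.
  by apply: (hg e'' he''); apply/In_cat; right.
by apply: (hg e' he'); apply/In_cat; left.
Qed.

Section Copies.
Context (L : language) (K D : Type) (U : structure L D) (slK : strong_limit K).
Context (satU : saturated K U) (homU : strongly_homogeneous K U).
Context (B : set D) (sB : small K B).

Lemma aclP (C : set D) (e : D) : acl U C e <->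
  exists P : (unit -> D) -> Prop,
    [/\ dfn U C P, P (fun=> e) & finite_set [set x | P (fun=> x)]].
Proof.
split=> [[phi [op sp fp]]|[P [/dfn_over[phi op hphi] Pe fP]]].
  by exists (fun a => sat U a phi); split=> //; exact: dfn_sat.
exists phi; split=> //; first exact/hphi.
by apply: sub_finite_set fP => x /= /hphi.
Qed.

Lemma acl_subset (C C' : set D) : C `<=` C' -> acl U C `<=` acl U C'.
Proof.
move=> CC' e [phi [op sp fp]]; exists phi; split=> //.
exact: over_subset op.
Qed.

(** A formula over [B] true of [e] has infinitely many solutions, so saturation
    gives a realization of [tp(e/B)] outside [F], and homogeneity moves [e]
    there. *)
Lemma orbit_infinite (e : D) (F : seq D) : ~ acl U B e ->
  exists2 s, automorphism U s /\ fixes B s & ~ List.In (s e) F.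
Proof.
move=> ne.
have sF : small K (B `|` [set f | List.In f F]).
  apply: small_setU => //; have [d0] := s_inh U.
  apply: small_subset (small_image (nth d0 F) slK.1) => f /(In_nthP d0)[i _ <-].
  by exists i.
pose Q := [set R : (unit -> D) -> Prop | exists P, [/\ dfn U B P, P (fun=> e) &
  R = (fun y => P y /\ ~ List.In (y tt) F)]].
have [_ [P [dP _ ->]]|s hs|y hy] := compactness (Q := Q) slK satU
    (small_countType slK unit) sF.
- apply: dfn_and; first by apply: dfn_subset dP => d; left.
  pose P' f (y : unit -> D) := ~ y tt = f.
  apply: dfn_iff (dfn_forall_In (P := P') (s := F) _) => [y|f fF].
    by split=> [h /h|h f fF ef]; [apply | apply: h; rewrite ef].
  by apply: dfn_not; apply: dfn_eq_param; right.
- have [P [dP Pe hP]] : exists P, [/\ dfn U B P, P (fun=> e) &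
      forall y, P y -> ~ List.In (y tt) F -> forall R, List.In R s -> R y].
    elim: s hs => [|R s IH] hs.
      by exists (fun=> True); split=> //; exact: dfn_true.
    have [P [dP Pe hP]] := IH (fun R hR => hs R (or_intror hR)).
    have [P' [dP' Pe' ->]] := hs R (or_introl erefl).
    exists (fun y => P y /\ P' y); split=> //; first exact: dfn_and.
    by move=> y [h1 h2] nF R' [<-|hR]; [split | apply: hP].
  suff [x [Px nF]] : exists x, P (fun=> x) /\ ~ List.In x F.
    by exists (fun=> x); apply: hP.
  apply: contrapT => no; apply/ne/aclP; exists P; split=> //.
  apply: (@sub_finite_set _ _ [set f | List.In f F]).
    move=> x Px; apply: contrapT => nF; apply: no; by exists x.
  by apply/finite_set_In; exists F.
have [|s [sA sB' es]] := @homogeneous_over L D U K unit B (fun=> e) y slK homU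
    (small_countType slK unit) sB.
  move=> th hth.
  by have [] := hy _ (ex_intro _ _ (And3 (ex_intro _ th (fun=> iff_refl _)) hth erefl)).
exists s => //; have [_] := hy _ (ex_intro _ (fun=> True)
   (And3 (dfn_true U unit B) I erefl)).
by rewrite -es.
Qed.

Fixpoint disjoint_copies (es : seq D) (ss : seq (D -> D)) : Prop :=
  match ss with
  | [::] => True
  | s :: ss' => (forall s' e e', List.In s' ss' -> List.In e es ->
      List.In e' es -> s e <> s' e') /\ disjoint_copies es ss'
  end.

Lemma disjoint_copies_mask es ss (p : pred (D -> D)) :
  disjoint_copies es ss -> disjoint_copies es [seq s <- ss | p s].
Proof.
elim: ss => //= s ss IH [h1 h2]; case: ifP => _; last exact: IH.
split; last exact: IH.
by move=> s' e e' /In_filter[hs' _]; apply: h1.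
Qed.

Lemma disjoint_copies_ex (es : seq D) (N : nat) :
  (forall e, List.In e es -> ~ acl U B e) ->
  exists ss, [/\ size ss = N, disjoint_copies es ss &
    forall s, List.In s ss -> automorphism U s /\ fixes B s].
Proof.
move=> hes; elim: N => [|N [ss [<- dss hss]]]; first by exists [::].
have [||||s [sA sB'] hs] := @neumann D (fun s => automorphism U s /\ fixes B s) es
    _ _ _ _ (flatten [seq [seq s e | e <- es] | s <- ss]).
- by split=> //; exact: auto_id.
- by move=> g h [gA gB] [hA hB]; split; [exact: auto_comp | exact: fixes_comp].
- move=> g [gA gB]; have [g' [g'A gK g'K]] := auto_inv gA.
  by exists g'; split=> //; split=> //; exact: fixes_inv gB.
- by move=> e /hes ne F; apply: orbit_infinite.
exists (s :: ss); split=> //=; last by move=> s' [<-|/hss].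
split=> // s' e e' hs' he he' ee; apply: (hs e he).
apply/In_flatten; exists [seq s' e | e <- es]; apply/In_map; first by exists s'.
by exists e'.
Qed.

End Copies.

(** * Algebraically reasonable extension *)

Section ReasonableExtension.
Context (L : language) (K D : Type) (U : structure L D) (slK : strong_limit K).
Context (satU : saturated K U) (homU : strongly_homogeneous K U) (hN : NSOP1 U).
Context (M : set D) (sM : small K M) (eM : elementary U M).

Lemma dfn_const (X : Type) (C : set D) (p : Prop) : dfn U C (fun _ : X -> D => p).
Proof.
have [hp|hp] := pselect p.
  by apply: dfn_iff (dfn_true U X C).
by apply: dfn_iff (dfn_not (dfn_true U X C)) => a; split=> // /(_ I).
Qed.

Lemma dfn_fixes (X : Type) (C : set D) (P : (X -> D) -> Prop) s a :
  dfn U C P -> automorphism U s -> fixes C s -> P (s \o a) <-> P a.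
Proof. by move=> [th h] sA sC; rewrite -!h holds_fixes. Qed.

(** By compactness, a type over a small set that implies a Kim-dividing formula
    [phi(x;d)] contains a formula that does, wherever [d] lies. *)
Lemma kim_indepP (I J : Type) (C : set D) (a : I -> D) (c : J -> D) :
  small K [set: I] -> small K [set: J] ->
  (forall psi, over (M `|` range c) psi -> kim_implies U M psi -> ~ sat U a psi) ->
  kim_indep U M a c.
Proof.
move=> sI sJ h [n [phi [d [himp kd]]]].
set C' := M `|` range c in h himp.
have sC : small K (C' `|` range d).
  apply: small_setU_range => //; first exact: small_setU_range.
  exact: small_ord.
pose Q := [set P | exists psi, [/\ over C' psi, sat U a psi &
  P = (fun x => sat U x psi /\ ~ sat U x (inst d phi))]].
have ndphi : dfn U (C' `|` range d) (fun x => ~ sat U x (inst d phi)).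
  apply: dfn_not; apply: dfn_iff (dfn_param (c := d) U phi _) => [x|e [i _ <-]].
    by rewrite sat_inst.
  by right; exists i.
have [_ [psi [opsi _ ->]]|s hs|x hx] := compactness (Q := Q) slK satU sI sC.
- apply: dfn_and ndphi; apply: dfn_sat; apply: over_subset opsi.
  by move=> e; left.
- have [psi [opsi apsi hpsi]] : exists psi, [/\ over C' psi, sat U a psi &
      forall x, sat U x psi -> ~ sat U x (inst d phi) -> forall P, List.In P s -> P x].
    elim: s hs => [|P s IH] hs.
      have [psi opsi hpsi] := dfn_over (dfn_true U I C').
      by exists psi; split=> //; apply/hpsi.
    have [psi [opsi apsi hpsi]] := IH (fun P hP => hs P (or_intror hP)).
    have [psi' [opsi' apsi' ->]] := hs P (or_introl erefl).
    have [ps ops hps] := dfn_over (dfn_and (dfn_sat U opsi) (dfn_sat U opsi')).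
    exists ps; split=> //; first by apply/hps.
    by move=> x /hps[h1 h2] nx R [<-|hR]; [split | apply: hpsi].
  apply: contrapT => no; apply: (h psi opsi _ apsi).
  exists n, phi, d; split=> // x sx; apply: contrapT => nx; apply: no.
  by exists x; apply: hpsi.
have [psi0 opsi0 hpsi0] := dfn_over (dfn_true U I C').
have [|_ nx] := hx (fun x => sat U x psi0 /\ ~ sat U x (inst d phi)).
  by exists psi0; split=> //; apply/hpsi0.
apply/nx/himp => psi [opsi apsi].
have [] // := hx (fun x => sat U x psi /\ ~ sat U x (inst d phi)).
by exists psi.
Qed.

(** The obstruction to algebraic independence. Finiteness not being definable,
    [chi(-, x)] is required to have at most [k] solutions. *)
Definition algebraic_meet (I : Type) (xi : (unit -> D) -> Prop)
    (chi : (unit + I -> D) -> Prop) (k : nat) (x : I -> D) : Prop :=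
  exists w : unit -> D, (xi w /\ chi (tuple_cat w x)) /\
    ~ exists z : 'I_k.+1 -> D,
      (forall i j, i != j -> z i <> z j) /\
      forall i, chi (tuple_cat (fun=> z i) x).

Lemma dfn_algebraic_meet (I : Type) (C : set D) (xi : (unit -> D) -> Prop)
    (chi : (unit + I -> D) -> Prop) (k : nat) :
  dfn U C xi -> dfn U C chi -> dfn U C (algebraic_meet xi chi k).
Proof.
move=> dxi dchi.
pose f (w : unit) : unit + I := inl w.
apply: dfn_iff (dfn_ex (dfn_and (dfn_and (dfn_comp (@inl unit I) dxi) dchi)
  (dfn_comp (@inr unit I) (dfn_not (dfn_ex (W := 'I_k.+1) (dfn_and
    (dfn_forall_fin (fun i => dfn_forall_fin (fun j => dfn_imp
      (dfn_const _ _ (i != j)) (dfn_not (dfn_eq U C (inl i) (inl j))))))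
    (dfn_forall_fin (fun i => dfn_comp (fun w : unit + I => match w with
       | inl _ => inl i | inr y => inr y end) dchi)))))))) => x.
have e (z : 'I_k.+1 -> D) (x' : I -> D) i : tuple_cat z x' \o (fun w : unit + I => match w with
       | inl _ => inl i | inr y => inr y end) = tuple_cat (fun=> z i) x'.
  by apply/funext => -[].
split=> -[w [h1 h2]]; exists w; split=> // -[z [z1 z2]]; apply: h2; exists z; split=> //.
  by move=> i; rewrite e; apply: z2.
by move=> i; have := z2 i; rewrite e.
Qed.

Lemma finite_solutions_bound (P : D -> Prop) : finite_set [set x | P x] ->
  exists k, ~ exists z : 'I_k.+1 -> D, (forall i j, i != j -> z i <> z j) /\ forall i, P (z i).
Proof.
move=> /finite_listP[s hs]; exists (size s) => -[z [z1 z2]].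
have : size [seq (z i : {classic D}) | i <- enum 'I_(size s).+1] <= size (s : seq {classic D}).
  apply: uniq_leq_size.
    rewrite map_inj_uniq ?enum_uniq // => i j ij; apply: contrapT => ne.
    by apply: z1 ij; apply/eqP.
  by move=> x /mapP[i _ ->]; apply/In_mem/hs; apply: z2.
by rewrite size_map size_enum_ord ltnn.
Qed.

Context (I J H : Type) (sI : small K [set: I]) (sJ : small K [set: J])
  (sH : small K [set: H]) (a : I -> D) (b : J -> D) (c : H -> D).
Context (hab : kim_indep U M a b).

Let B := M `|` range b.
Let C := B `|` range c.

Let sB : small K B. Proof. exact: small_setU_range. Qed.

(** The obstructions that [a'] has to avoid. The elements of [acl(C)] outside
    [acl(B)] are not named but grouped into finite sets [xi] definable over [C],
    so that no bound on the cardinality of [acl(C)] is needed. *)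
Let avoided (it : ((unit -> D) -> Prop) * ((unit + I -> D) -> Prop) * nat) :=
  [/\ dfn U C it.1.1, finite_set [set e | it.1.1 (fun=> e)],
      forall w, it.1.1 w -> ~ acl U B (w tt) & dfn U B it.1.2].

(** Take sufficiently many automorphisms [t] over [B] that send the solutions
    of the [xi] to disjoint sets, and [a'] satisfying [psi] but none of the
    images of the formulas [ths] under the [t]. The solutions of [chi(-, a')]
    being at most [k], some [t] is such that none of them is in the images
    under [t] of the sets [xi]; pull [a'] back by this [t]. *)
Lemma reasonable_extension_fin psi (ths : seq (form L (I + D))) its :
  over B psi -> sat U a psi ->
  (forall th, List.In th ths -> kim_implies U M th) ->
  (forall it, List.In it its -> avoided it) ->
  exists x, [/\ sat U x psi, forall th, List.In th ths -> ~ sat U x th &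
    forall it, List.In it its -> ~ algebraic_meet it.1.1 it.1.2 it.2 x].
Proof.
move=> opsi apsi hths hits.
have MB : M `<=` B by move=> m; left.
have [es [es1 es2]] : exists es, (forall e, List.In e es -> ~ acl U B e) /\
    forall it w, List.In it its -> it.1.1 w -> List.In (w tt) es.
  elim: its hits => [|it its IH] hits; first by exists [::].
  have [es [es1 es2]] := IH (fun i hi => hits i (or_intror hi)).
  have [_ /finite_listP[s hs] h _] := hits it (or_introl erefl).
  exists (s ++ es); split=> [e /In_cat[/hs xie|/es1//]|it' w].
    exact: (h _ xie).
  case=> [<-|hit'] xiw; apply/In_cat; last by right; apply: es2 hit' xiw.
  left; apply/hs => /=; rewrite (_ : (fun=> w tt) = w) //.
  by apply/funext => -[].
pose it0 : ((unit -> D) -> Prop) * ((unit + I -> D) -> Prop) * nat :=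
  (fun=> False, fun=> False, 0).
pose it j := nth it0 its j.
set m := size its.
pose k := \max_(j < m) (it j).2.
have [ss [szs dss hss]] := disjoint_copies_ex slK satU homU sB (m * k).+1 es1.
have [|x [px hx]] := kim_extension_fin slK satU homU hN sM eM hab opsi apsi
    (s := flatten [seq [seq inst t th | th <- ths] | t <- ss]).
  move=> _ /In_flatten[_ /In_map[t /hss[tA tB] <-] /In_map[th /hths kth <-]].
  by apply: kim_implies_auto => // e /MB/tB.
apply: contrapT => no.
pose R j (t : D -> D) := exists w : unit -> D,
  [/\ (it j).1.1 w, (it j).1.2 (tuple_cat (t \o w) x) &
    ~ exists z : 'I_(it j).2.+1 -> D, (forall i i', i != i' -> z i <> z i') /\
       forall i, (it j).1.2 (tuple_cat (fun=> z i) x)].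
have [t ht||j jm] := @pigeonhole _ R m k ss; rewrite ?szs //.
  have [tA tB] := hss t ht; have [t' [t'A tK t'K]] := auto_inv tA.
  have ex : x = t \o (t' \o x) by apply/funext => i /=; rewrite t'K.
  have [i hi hm] : exists2 i, List.In i its & algebraic_meet i.1.1 i.1.2 i.2 (t' \o x).
    apply: contrapT => no'; apply: no; exists (t' \o x); split.
    - by apply/(dfn_fixes _ (dfn_sat U opsi) tA tB); rewrite -ex.
    - move=> th hth sth; apply: (hx (inst t th)).
        by apply/In_flatten; exists [seq inst t th | th <- ths]; apply/In_map;
          [exists t | exists th].
      by rewrite ex sat_inst_auto.
    - by move=> i hi hm; apply: no'; exists i.
  have [j jm ej] := In_nthP it0 hi; exists j => //.
  have [_ _ _ dchi] := hits i hi.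
  have move_t Z (u : Z -> D) : tuple_cat (t \o u) x = t \o tuple_cat u (t' \o x).
    by rewrite {1}ex; apply/funext => -[].
  rewrite -ej -/(it j) in hm dchi; have [w [[w1 w2] w3]] := hm.
  exists w; split=> //.
    by rewrite move_t; apply/(dfn_fixes _ dchi tA tB).
  move=> [z [z1 z2]]; apply: w3; exists (t' \o z); split=> [i1 i2 /z1 ne /=|i1].
    by move/(can_inj t'K).
  apply/(dfn_fixes _ dchi tA tB); rewrite -move_t.
  by rewrite (_ : t \o _ = fun=> z i1) //; apply/funext => u /=; rewrite t'K.
set ts := [seq t <- ss | `[< R j t >]] => lt.
have hts t : List.In t ts -> R j t by move=> /In_filter[_ /asboolP].
have tss t : List.In t ts -> List.In t ss by move=> /In_filter[].
have dts : disjoint_copies es ts by exact: disjoint_copies_mask.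
have hit : List.In (it j) its by apply: In_nth.
have [ys [sy uy hy]] : exists ys : seq {classic D}, [/\ size ys = size ts, uniq ys &
    forall y, y \in ys -> (it j).1.2 (tuple_cat (fun=> y) x) /\
      exists t e, [/\ List.In t ts, List.In e es & y = t e]].
  move: ts hts dts {lt tss} => ts; elim: ts => [|t ts IH] hts dts.
    by exists [::].
  have [ys [sy uy hy]] := IH (fun t ht => hts t (or_intror ht)) dts.2.
  have [w [w1 w2 _]] := hts t (or_introl erefl).
  exists ((t (w tt) : {classic D}) :: ys); split; first by rewrite /= sy.
    rewrite /= uy andbT; apply/negP => /hy[_ [t' [e [ht' he e']]]].
    exact: (dts.1 t' (w tt) e ht' (es2 _ _ hit w1) he e').
  move=> y; rewrite inE => /orP[/eqP->|/hy[h1 [t' [e [ht' he e']]]]].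
    split; last by exists t, (w tt); split=> //; [left | exact: es2 hit w1].
    by rewrite (_ : (fun=> _) = t \o w) //; apply/funext => -[].
  by split=> //; exists t', e; split=> //; right.
have kj : (it j).2 < size ys.
  by rewrite sy; apply: leq_trans lt; rewrite ltnS /k (bigmax_sup (Ordinal jm)).
have [t0 ht0] : exists t, List.In t ts.
  by case: (ts) lt => // t ts' _; exists t; left.
have [w [_ _]] := hts t0 ht0; apply.
exists (fun i : 'I_(it j).2.+1 => nth (w tt : {classic D}) ys i); split=> [i i' ne|i].
  move=> e; move: ne; apply/negP; rewrite negbK; apply/eqP/val_inj/eqP.
  have lt_ys (l : 'I_(it j).2.+1) : l < size ys := leq_trans (ltn_ord l) kj.
  rewrite -(nth_uniq (w tt : {classic D}) (lt_ys i) (lt_ys i') uy).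
  by apply/eqP; exact: e.
by apply: (hy _ _).1; apply: mem_nth; exact: leq_trans (ltn_ord i) kj.
Qed.

Lemma range_tuple_cat (X Y : Type) (u : X -> D) (v : Y -> D) :
  range (tuple_cat u v) = range u `|` range v.
Proof.
apply/seteqP; split=> [_ [[x|y] _ <-]|_ [[x _ <-]|[y _ <-]]].
- by left.
- by right.
- by exists (inl x).
- by exists (inr y).
Qed.

(** Let [e] be a common element of [acl(Ba')] and [acl(C)] outside [acl(B)], and
    take a finite set over [C] that contains [e]. Each of its elements in
    [acl(B)] lies in a finite set over [B], which does not contain [e]; removing
    these sets leaves the required [xi]. *)
Lemma alg_indep_avoided (a' : I -> D) :
  (forall it, avoided it -> ~ algebraic_meet it.1.1 it.1.2 it.2 a') ->
  alg_indep U B a' c.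
Proof.
move=> h; apply/seteqP; split=> [e [ea ec]|e ea]; last first.
  by split; apply: acl_subset ea => x; left.
apply: contrapT => ne.
have [P [dP Pe /finite_listP[s hs]]] := (aclP U C e).1 ec.
have [Z [dZ nZe hZ]] : exists Z : (unit -> D) -> Prop, [/\ dfn U B Z, ~ Z (fun=> e) &
    forall x, List.In x s -> acl U B x -> Z (fun=> x)].
  elim: s {hs} => [|x s [Z [dZ nZe hZ]]].
    by exists (fun=> False); split=> //; exact: dfn_const.
  have [/aclP[P' [dP' Px fP']]|nx] := pselect (acl U B x); last first.
    by exists Z; split=> // y [<-//|/hZ].
  exists (fun y => ~ (~ Z y /\ ~ P' y)); split.
  - by apply: dfn_not; apply: dfn_and; exact: dfn_not.
  - apply; split=> // P'e; apply: ne; apply/aclP; by exists P'.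
  - by move=> y [<-|/hZ hy] acly [] //; move/(_ (hy acly)).
have [Q [dQ Qe fQ]] := (aclP U _ e).1 ea.
have [th hth] := dQ.
have /choice[g hg] : forall d : (B `|` range a' : set D), exists w : I + B,
    tuple_cat a' (fun b : B => val b) w = val d.
  move=> [d /= hd]; have [Bd|[i _ <-]] := set_mem hd; last by exists (inl i).
  by exists (inr (exist _ d (mem_set Bd))).
pose chi (v : unit + I -> D) :=
  holds U (tuple_cat (v \o inl) (tuple_cat (v \o inr) (fun b : B => val b) \o g)) th.
have chiQ w : chi (tuple_cat w a') <-> Q w.
  rewrite -hth /chi (_ : tuple_cat (tuple_cat w a' \o inr) _ \o g = fun d => val d) //.
  by apply/funext => d; rewrite -hg.
have dchi : dfn U B chi.
  pose f (w : unit + (B `|` range a' : set D)) : (unit + I) + B := match w with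
    | inl u => inl (inl u)
    | inr d => match g d with inl i => inl (inr i) | inr b => inr b end end.
  exists (fmap f th) => v; rewrite holds_fmap /chi.
  rewrite (_ : _ \o f = tuple_cat (v \o inl) (tuple_cat (v \o inr) (fun b : B => val b) \o g)) //.
  by apply/funext => -[u|d] //=; case: (g d).
have [k hk] := finite_solutions_bound fQ.
apply: (h (fun w => P w /\ ~ Z w, chi, k)).
  split=> //=.
  - apply: dfn_and => //; apply: dfn_not; apply: dfn_subset dZ => x Bx.
    by left.
  - by apply: (@sub_finite_set _ _ [set x | List.In x s]) => [x [Px _]|];
      [apply/hs | apply/finite_set_In; exists s].
  - move=> w [Pw nZw] aclw; apply: nZw.
    rewrite (_ : w = fun=> w tt) in Pw *; last by apply/funext => -[].
    by apply: hZ => //; apply/hs.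
exists (fun=> e); split; first by split; [split | apply/chiQ].
move=> [z [z1 z2]]; apply: hk; exists z; split=> // i.
by apply/chiQ; exact: z2.
Qed.

(** The conditions on [a'] are definable over the small set [C] and finitely
    satisfiable by [reasonable_extension_fin]. *)
Theorem reasonable_extension : exists a' : I -> D,
  [/\ tp U a' B = tp U a B, kim_indep U M a' (tuple_cat b c) & alg_indep U B a' c].
Proof.
have sC : small K C by exact: small_setU_range.
have CE : M `|` range (tuple_cat b c) = C by rewrite range_tuple_cat setUA.
have BC : B `<=` C by move=> x; left.
pose Q := [set P : (I -> D) -> Prop |
  (exists2 psi, tp U a B psi & P = (fun x => sat U x psi)) \/
  (exists th, [/\ over C th, kim_implies U M th & P = (fun x => ~ sat U x th)]) \/
  (exists2 it, avoided it & P = (fun x => ~ algebraic_meet it.1.1 it.1.2 it.2 x))].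
have [P|s hs|a' ha'] := compactness (Q := Q) slK satU sI sC.
- case=> [[psi [opsi _] ->]|[[th [oth _ ->]]|[it [d1 d2 d3 d4] ->]]].
  + by apply: dfn_sat; apply: over_subset opsi.
  + by apply: dfn_not; apply: dfn_sat.
  + by apply: dfn_not; apply: dfn_algebraic_meet => //; apply: dfn_subset d4.
- suff [psi [ths [its [[opsi apsi] hths hits h]]]] : exists psi ths its,
      [/\ tp U a B psi, forall th, List.In th ths -> kim_implies U M th,
          forall it, List.In it its -> avoided it &
          forall x, sat U x psi -> (forall th, List.In th ths -> ~ sat U x th) ->
            (forall it, List.In it its -> ~ algebraic_meet it.1.1 it.1.2 it.2 x) ->
            forall P, List.In P s -> P x].
    have [x [h1 h2 h3]] := reasonable_extension_fin opsi apsi hths hits.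
    by exists x; apply: h.
  elim: s hs => [|P s IH] hs.
    have [psi opsi hpsi] := dfn_over (dfn_true U I B).
    by exists psi, [::], [::]; split=> //; split=> //; apply/hpsi.
  have [psi [ths [its [[opsi apsi] hths hits h]]]] := IH (fun P hP => hs P (or_intror hP)).
  case: (hs P (or_introl erefl)) =>
      [[psi' [opsi' apsi'] ->]|[[th [oth kth ->]]|[it ait ->]]].
  + have [ps ops hps] := dfn_over (dfn_and (dfn_sat U opsi) (dfn_sat U opsi')).
    exists ps, ths, its; split=> //; first by split=> //; apply/hps.
    by move=> x /hps[h1 h1'] h2 h3 R [<-|] //; apply: h.
  + exists psi, (th :: ths), its; split=> // [th' [<-//|/hths//]|x h1 h2 h3 R [<-|]].
      by apply: h2; left.
    by apply: h => // th' hth'; apply: h2; right.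
  + exists psi, ths, (it :: its); split=> // [it' [<-//|/hits//]|x h1 h2 h3 R [<-|]].
      by apply: h3; left.
    by apply: h => // it' hit'; apply: h3; right.
have tpa psi : tp U a B psi -> sat U a' psi.
  by move=> h; apply: (ha' (fun x => sat U x psi)); left; exists psi.
exists a'; split.
- apply/seteqP; split=> psi [opsi spsi]; split=> //; last by apply: tpa.
  apply: contrapT => nsat; suff : sat U a' (fNot psi) by move/(_ spsi).
  by apply: tpa; split=> //; case: opsi => th _ <-; exists (fNot th).
- apply: kim_indepP => //; first exact: small_sum.
  rewrite CE => psi opsi kpsi; apply: (ha' (fun x => ~ sat U x psi)).
  by right; left; exists psi.
- apply: alg_indep_avoided => it ait.
  apply: (ha' (fun x => ~ algebraic_meet it.1.1 it.1.2 it.2 x)).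
  by right; right; exists it.
Qed.

End ReasonableExtension.

Theorem theorem2p15 (L : language) (T : set (sentence L)) (K D : Type)
    (U : structure L D) (hT : complete_theory T) (hU : monster K T U)
    (hN : NSOP1 U) (M : set D) (hM : elementary U M) (hMs : small K M)
    (I J H : Type) (hI : small K [set: I]) (hJ : small K [set: J])
    (hH : small K [set: H]) (a : I -> D) (b : J -> D) (c : H -> D)
    (hab : kim_indep U M a b) :
  exists a' : I -> D,
    [/\ tp U a' (M `|` range b) = tp U a (M `|` range b),
        kim_indep U M a' (tuple_cat b c) &
        alg_indep U (M `|` range b) a' c].
Proof.
have [slK _ _ satU homU] := hU.
exact: (reasonable_extension slK satU homU hN hMs hM hI hJ hH c hab).
Qed.
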